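(* Let $q(y|\eta)=\exp(\eta s(y)-\kappa(\eta))$, $y\in\mathcal{Y}$, $\eta\in\mathcal{E}$, be a one-parameter exponential family as in the context, and let $\mathcal{X}\subseteq\mathbb{R}^D$ and $\Theta\subseteq\mathbb{R}^D$, where $\Theta$ is open and convex and $\theta^{T}x\in\mathcal{E}$ for all $\theta\in\Theta$, $x\in\mathcal{X}$. Suppose $(X_1,Y_1),(X_2,Y_2),\ldots\in\mathcal{X}\times\mathcal{Y}$ are i.i.d. such that: (1) $f'(\theta_0)=0$ for some $\theta_0\in\Theta$, where $f(\theta)=-\mathbb{E}\log q(Y_i\mid\theta^{T}X_i)$; (2) $\mathbb{E}|X_is(Y_i)|<\infty$ and $\mathbb{E}|\kappa(\theta^{T}X_i)|<\infty$ for all $\theta\in\Theta$; (3) for all $a\in\mathbb{R}^D$, if $a^{T}X_i=0$ almost surely then $a=0$; and (4) there is an open ball $E\subseteq\mathbb{R}^D$ such that $\theta_0\in E$, $\bar E\subseteq\Theta$, and for all $j,k,\ell\in\{1,\ldots,D\}$, $\mathbb{E}\big(\sup_{\theta\in\bar E}|\kappa'''(\theta^{T}X_i)X_{ij}X_{ik}X_{i\ell}|\big)<\infty$. Then for any open ball $E$ satisfying condition (4), with probability $1$ the sequence $$f_n(\theta):=-\frac1n\sum_{i=1}^n\log q(Y_i\mid\theta^{T}X_i),\qquad\theta\in\Theta,$$ satisfies condition (CN) with respect to $(\Theta,\theta_0,E)$, as defined in the context.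
   Context: One-parameter exponential family. $\lambda$ is a sigma-finite Borel measure on $\mathcal{Y}\subseteq\mathbb{R}^d$, $s:\mathcal{Y}\to\mathbb{R}$ is measurable, $\kappa(\eta)=\log\int_{\mathcal{Y}}\exp(\eta s(y))\,\lambda(dy)$, $\mathcal{E}=\{\eta\in\mathbb{R}:|\kappa(\eta)|<\infty\}$ is assumed open and nonempty, and $\eta\mapsto Q_\eta$ is assumed one-to-one on $\mathcal{E}$, where $Q_\eta(A)=\int_Aq(y|\eta)\,\lambda(dy)$. Condition (CN). Let $\Theta\subseteq\mathbb{R}^D$, $\theta_0\in\Theta$, $E\subseteq\Theta$. A sequence of functions $f_n:\Theta\to\mathbb{R}$, $n\in\mathbb{N}$, satisfies (CN) with respect to $(\Theta,\theta_0,E)$ if: $E$ is open in $\mathbb{R}^D$ and bounded, with $\theta_0\in E$; each $f_n$ has continuous third derivatives on $E$; there is $g:\Theta\to\mathbb{R}$ such that $f_n\to g$ pointwise on $\Theta$ and the Hessian $g''(\theta_0)$ exists and is positive definite; $(f_n''')$ is uniformly bounded on $E$; and at least one of the following holds: (i) $g(\theta)>g(\theta_0)$ for all $\theta\in K\setminus\{\theta_0\}$ and $\liminf_n\inf_{\theta\in\Theta\setminus K}f_n(\theta)>g(\theta_0)$ for some compact $K\subseteq E$ with $\theta_0$ in the interior of $K$; or (ii) each $f_n$ is convex and $g'(\theta_0)=0$. Here $'$ and $''$ denote gradient and Hessian, $f'''$ is the tensor of third partial derivatives with norm $\|T\|=(\sum_{i,j,k}T_{ijk}^2)^{1/2}$,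 and uniformly bounded on $E$ means $\{\|f_n'''(\theta)\|:\theta\in E,n\in\mathbb{N}\}$ is bounded. A function $h:\Theta\to\mathbb{R}$ is convex if $h(t\theta+(1-t)\theta')\le t\,h(\theta)+(1-t)\,h(\theta')$ whenever $\theta,\theta'\in\Theta$, $t\in[0,1]$ and $t\theta+(1-t)\theta'\in\Theta$. $\bar E$ is the closure of $E$, $|\cdot|$ the Euclidean norm, and $X_{ij}$ the $j$th coordinate of $X_i$. The infimum over the empty set is $+\infty$. All functions and sets are assumed measurable. The model is not assumed to be correctly specified. *)

(* Defs.v *)
(* R^n is 'rV[R]_n.  Its library norm `|.| and library balls are those of the
   sup norm; the Euclidean norm and Euclidean balls are defined below.  Both
   norms induce the same topology. *)
From HB Require Import structures.
From mathcomp Require Import all_boot all_order all_algebra finmap.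
From mathcomp Require Import all_classical all_reals all_analysis.

Set Implicit Arguments.
Unset Strict Implicit.
Unset Printing Implicit Defensive.

Import Order.TTheory GRing.Theory Num.Theory.
Import numFieldNormedType.Exports.

Local Open Scope classical_set_scope.
Local Open Scope ring_scope.

Definition borelRV (R : realType) (n : nat) : Type :=
  g_sigma_algebraType (@open 'rV[R]_n).

Section Euclidean.
Context {R : realType} {D : nat}.
Implicit Types u v : 'rV[R]_D.

Definition dot u v : R := \sum_(j < D) u 0 j * v 0 j.

Definition enorm u : R := Num.sqrt (dot u u).

Definition is_open_eball (E : set 'rV[R]_D) : Prop :=
  exists (c : 'rV[R]_D) (r : R), 0 < r /\ E = [set t | enorm (t - c) < r].

End Euclidean.

Section Calculus.
Context {R : realType} {D : nat}.
Implicit Types (f h : 'rV[R]_D -> R) (E Theta : set 'rV[R]_D) (t : 'rV[R]_D).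

(* 'D_v f is a total operator: existence of the derivative is a separate
   assertion in each of the predicates below. *)
Definition partial (j : 'I_D) f : 'rV[R]_D -> R :=
  fun t => 'D_(delta_mx 0 j : 'rV[R]_D) f t.

Definition grad f t : 'rV[R]_D := \row_j partial j f t.

Definition grad_vanishes f t : Prop := differentiable f t /\ grad f t = 0.

Definition hessian_exists f t : Prop :=
  (\forall u \near t, differentiable f u) /\ differentiable (grad f) t.

Definition hessian f t : 'M[R]_D := 'J (grad f) t.

Definition posdef (H : 'M[R]_D) : Prop :=
  H^T = H /\ forall v : 'rV[R]_D, v != 0 -> 0 < dot (v *m H) v.

Definition partial3 (i j k : 'I_D) f : 'rV[R]_D -> R :=
  partial i (partial j (partial k f)).

Definition continuous_third_derivatives E f : Prop :=
  forall (i j k : 'I_D) t, E t ->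
    [/\ derivable f t (delta_mx 0 k),
        derivable (partial k f) t (delta_mx 0 j),
        derivable (partial j (partial k f)) t (delta_mx 0 i) &
        {for t, continuous (partial3 i j k f)}].

Definition norm_third_derivative f t : R :=
  Num.sqrt (\sum_(i < D) \sum_(j < D) \sum_(k < D) partial3 i j k f t ^+ 2).

(* Theta need not be convex, hence no appeal to the library's
   [convex_function], which is meant for convex domains. *)
Definition convex_on Theta h : Prop :=
  forall (t t' : 'rV[R]_D) (a : R), Theta t -> Theta t' -> 0 <= a <= 1 ->
    Theta (a *: t + (1 - a) *: t') ->
    h (a *: t + (1 - a) *: t') <= a * h t + (1 - a) * h t'.

(* The functions are total; only their values on Theta matter, since the
   derivatives are taken at points of the open set E, which lies in Theta. *)
Definition CN Theta (theta0 : 'rV[R]_D) E (f : nat -> 'rV[R]_D -> R) : Prop :=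
  [/\ Theta theta0 /\ E `<=` Theta,
      [/\ open E, bounded_set E & E theta0],
      forall n, continuous_third_derivatives E (f n) &
      exists g : 'rV[R]_D -> R,
        [/\ forall t, Theta t -> f n t @[n --> \oo] --> g t,
            hessian_exists g theta0 /\ posdef (hessian g theta0),
            exists M : R, forall n t, E t -> norm_third_derivative (f n) t <= M &
            (exists K : set 'rV[R]_D,
               [/\ compact K /\ K `<=` E,
                   interior K theta0,
                   forall t, K t -> t != theta0 -> g theta0 < g t &
                   ((g theta0)%:E <
                    limn_einf (fun n =>
                      ereal_inf [set (f n t)%:E | t in Theta `\` K]))%E])
            \/
            ((forall n, convex_on Theta (f n)) /\ grad_vanishes g theta0)]].

End Calculus.

Section IID.
Context {d d' : measure_display} {Omega : measurableType d}
  {T : measurableType d'} {R : realType}.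

Definition identically_distributed (P : probability Omega R)
    (Z : nat -> Omega -> T) : Prop :=
  forall i j (A : set T), measurable A -> P (Z i @^-1` A) = P (Z j @^-1` A).

Definition mutually_independent (P : probability Omega R)
    (Z : nat -> Omega -> T) : Prop :=
  forall (J : {fset nat}) (A : nat -> set T), (forall i, measurable (A i)) ->
    P (\bigcap_(i in [set` J]) (Z i @^-1` A i)) =
    (\prod_(i <- J) P (Z i @^-1` A i))%E.

Definition iid (P : probability Omega R) (Z : nat -> Omega -> T) : Prop :=
  [/\ forall i, measurable_fun setT (Z i),
      identically_distributed P Z & mutually_independent P Z].

End IID.

(* The base measure on Y, a Borel subset of R^d, is carried by a measure on
   R^d of which only the restriction to Y is ever used. *)
Section ExponentialFamily.
Context {R : realType} {d : nat}.
Variables (lambda : {measure set (borelRV R d) -> \bar R})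
  (Y : set (borelRV R d)) (s : borelRV R d -> R).

Definition log_partition (eta : R) : \bar R :=
  lne (\int[lambda]_(y in Y) (expR (eta * s y))%:E)%E.

Definition natural_parameters : set R :=
  [set eta | (`|log_partition eta| < +oo)%E].

(* [kappa eta] is meaningful only for eta in [natural_parameters]: [fine]
   sends the infinities to 0. *)
Definition kappa (eta : R) : R := fine (log_partition eta).

Definition density (y : borelRV R d) (eta : R) : R :=
  expR (eta * s y - kappa eta).

Definition model (eta : R) (A : set (borelRV R d)) : \bar R :=
  (\int[lambda]_(y in A) (density y eta)%:E)%E.

Definition identifiable : Prop :=
  forall eta1 eta2, natural_parameters eta1 -> natural_parameters eta2 ->
    (forall A, measurable A -> A `<=` Y -> model eta1 A = model eta2 A) ->
    eta1 = eta2.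

Definition exponential_family : Prop :=
  [/\ measurable Y, sigma_finite Y lambda, measurable_fun Y s,
      open natural_parameters /\ natural_parameters !=set0 & identifiable].

End ExponentialFamily.

Section GLM.
Context {R : realType} {D d : nat} {disp : measure_display}
  {Omega : measurableType disp}.
Variables (lambda : {measure set (borelRV R d) -> \bar R})
  (Yset : set (borelRV R d)) (s : borelRV R d -> R)
  (P : probability Omega R)
  (X : nat -> Omega -> borelRV R D) (Y : nat -> Omega -> borelRV R d).

(* Observations are numbered from 0: X 0, Y 0 are the first pair, and
   [empirical_loss n] averages the first n.+1 pairs. *)
Definition empirical_loss (n : nat) (w : Omega) (theta : 'rV[R]_D) : R :=
  - (n.+1%:R^-1 * \sum_(i < n.+1)
       ln (density lambda Yset s (Y i w) (dot theta (X i w)))).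

Definition expected_loss (theta : 'rV[R]_D) : R :=
  - fine 'E_P[fun w =>
    ln (density lambda Yset s (Y 0%N w) (dot theta (X 0%N w)))].

Definition dominated_third_derivative (Theta : set 'rV[R]_D)
    (theta0 : 'rV[R]_D) (E : set 'rV[R]_D) : Prop :=
  [/\ is_open_eball E, E theta0, closure E `<=` Theta &
      forall j k l : 'I_D,
        (\int[P]_w ereal_sup
           [set (`| derive1n 3 (kappa lambda Yset s) (dot theta (X 0%N w))
                    * (X 0%N w : 'rV[R]_D) 0 j * (X 0%N w : 'rV[R]_D) 0 k
                    * (X 0%N w : 'rV[R]_D) 0 l |)%:E
           | theta in closure E] < +oo)%E].

End GLM.

(* Main.v *)
(* [f_n] is a convex function of [theta], so case (ii) of (CN) applies with
   [g] the expected loss.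

   Pointwise convergence.  Etemadi's strong law gives [f_n -> g] almost surely
   at all rational points of [Theta] simultaneously, and convex functions that
   converge on a dense subset of an open convex set to a convex function
   converge everywhere, because they are locally uniformly Lipschitz.

   Third derivatives.  [|f_n'''|] is at most the empirical mean of the envelope
   [sup_(theta in E) |kappa'''(theta . X)| (sum_j |X_j|)^3], which converges by
   the strong law again; the supremum may be taken over the rational points of
   [E], so it is measurable.

   Hessian of [g].  Taylor expansion of [kappa] to third order, with this
   envelope as remainder, first shows that [kappa''(theta . X) X_i X_j] and
   [kappa'(theta . X) X_j] are integrable (compare second and first differences
   of [kappa(theta . X)]) and then allows to differentiate twice under the
   expectation.  The Hessian is [E(kappa''(theta0 . X) X X^T)], positive
   definite by (3) since identifiability forces [kappa'' > 0]. *)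
From HB Require Import structures.
Require Import Defs.
From mathcomp Require Import all_boot all_order all_algebra.
From mathcomp Require Import all_classical all_reals all_analysis.
From mathcomp Require finmap.
From mathcomp Require Import measurable_realfun.
From mathcomp Require Import ring lra zify.

Set Implicit Arguments.
Unset Strict Implicit.
Unset Printing Implicit Defensive.

Import Order.TTheory GRing.Theory Num.Theory.
Import numFieldNormedType.Exports.

Local Open Scope classical_set_scope.
Local Open Scope ring_scope.

(** The parameter enters each loss only through the scalar theta . x, so the calculus is that of
    [kappa] in one variable, carried to R^D along the maps theta |-> theta . x. Differentiation
    under the expectation works with remainders bounded by a multiple of |v|^2, which yield Fréchet
    derivatives at once instead of limits of difference quotients; the price is a single integrable
    function dominating the third order on the whole of E. [kappa] and [s] are controlled only on
    the natural parameters and on Y, so their extensions by zero stand in for them wherever a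
    measurable function on the whole space is required. The strong law runs along blocks b, b +
    floor(b/L) + 1, ... instead of powers of a real number: indices stay integers, the two classical
    series estimates become telescoping sums, and nonnegativity fills the gaps between blocks. *)

(** * Expectation of a product of independent bounded variables *)

Section Independence.
Context {d : measure_display} {Omega : measurableType d} {R : realType}
  (P : probability Omega R).

Lemma bounded_probability_integrable (f : Omega -> R) :
  measurable_fun setT f -> [bounded f x | x in setT] ->
  P.-integrable setT (EFin \o f).
Proof.
move=> mf bf; apply: measurable_bounded_integrable => //.
by rewrite (le_lt_trans (probability_le1 P measurableT))// ltry.
Qed.

Definition independent_rv (U V : Omega -> R) : Prop :=
  forall A B, measurable A -> measurable B ->
    P (U @^-1` A `&` V @^-1` B) = (P (U @^-1` A) * P (V @^-1` B))%E.

Lemma independent_comp (U V : Omega -> R) (h k : R -> R) :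
  measurable_fun setT h -> measurable_fun setT k ->
  independent_rv U V -> independent_rv (h \o U) (k \o V).
Proof.
move=> mh mk UV A B mA mB.
have mhA : measurable (h @^-1` A) by have := mh measurableT A mA; rewrite setTI.
have mkB : measurable (k @^-1` B) by have := mk measurableT B mB; rewrite setTI.
exact: (UV _ _ mhA mkB).
Qed.

(** The law of the pair agrees with the product of the marginal laws on rectangles, hence
    everywhere, and Fubini splits the integral of the product. Bounded variables suffice because
    only truncated ones are multiplied later. *)
Lemma Rintegral_indepM (U V : Omega -> R) :
  measurable_fun setT U -> measurable_fun setT V ->
  [bounded U x | x in setT] -> [bounded V x | x in setT] ->
  independent_rv U V ->
  \int[P]_w (U w * V w) = (\int[P]_w U w) * (\int[P]_w V w).
Proof.
move=> mU mV bU bV UV.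
pose X : {RV P >-> R} := mfun_Sub (mem_set mU).
pose Y : {RV P >-> R} := mfun_Sub (mem_set mV).
have mXY : measurable_fun setT (fun w => (U w, V w)).
  exact: measurable_fun_pair.
pose XY : {RV P >-> (R * R)%type} := mfun_Sub (mem_set mXY).
have iU := bounded_probability_integrable mU bU.
have iV := bounded_probability_integrable mV bV.
pose f (z : R * R) : \bar R := (z.1 * z.2)%:E.
have mM : measurable_fun setT f.
  by apply/measurable_EFinP; exact: measurable_funM.
have midE : measurable_fun [set: R] (EFin \o id) by exact/measurable_EFinP.
have idX : (distribution P X).-integrable setT (EFin \o id).
  exact: (integrable_pushforward mU midE iU measurableT).
have idY : (distribution P Y).-integrable setT (EFin \o id).
  exact: (integrable_pushforward mV midE iV measurableT).
have prodE : \int[P]_w (U w * V w) =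
    fine (\int[distribution P X \x distribution P Y]_z f z)%E.
  rewrite /Rintegral; congr fine.
  transitivity (\int[distribution P XY]_z f z)%E.
    rewrite integral_distribution//.
    by have := integrableMr measurableT mU bU iV.
  apply: eq_measure_integral => A mA _; apply/esym.
  by apply: product_measure_unique.
have ipr : (distribution P X \x distribution P Y)%E.-integrable setT f.
  apply/integrable12ltyP => //=.
  have E x : (\int[distribution P Y]_y `|f (x, y)| =
      `|x%:E| * \int[distribution P Y]_y `|y%:E|)%E.
    rewrite -[`|x%:E|%E]/(`|x|%:E) -(integralZl measurableT (integrable_abse idY)).
    by apply: eq_integral => y _; rewrite /f /= normrM.
  under eq_integral do rewrite E.
  have fY : (\int[distribution P Y]_x `|x%:E| < +oo)%E.
    by case/integrableP : idY.
  rewrite ge0_integralZr//; last 2 first.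
    by case/integrableP : (integrable_abse idX).
    exact: integral_ge0.
  by rewrite lte_mul_pinfty ?integral_ge0// ge0_fin_numE ?integral_ge0//;
    case/integrableP : idX.
have E x : fubini_F (distribution P Y) f x = (x%:E * \int[P]_w (V w)%:E)%E.
  transitivity (x%:E * \int[distribution P Y]_y (EFin \o id) y)%E.
    by rewrite -(integralZl measurableT idY).
  by rewrite (integral_pushforward mV midE iV measurableT) preimage_setT.
rewrite prodE -integral12_prod_meas1//.
under eq_integral do rewrite E.
have fV : (\int[P]_w (V w)%:E)%E \is a fin_num by exact: integrable_fin_num.
have -> : (\int[distribution P X]_x (x%:E * \int[P]_w (V w)%:E) =
    \int[P]_w (U w)%:E * \int[P]_w (V w)%:E)%E.
  rewrite -(fineK fV) (integralZr measurableT idX); congr *%E.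
  by rewrite (integral_pushforward mU midE iU measurableT) preimage_setT.
by rewrite fineM//; exact: integrable_fin_num.
Qed.
End Independence.

(** * Integer blocks of geometric growth *)

Section Blocks.
Context {R : realType}.
Implicit Types (L n m : nat) (u : R).

(** An integer substitute for (1 + 1/L)^n: the quotient gives the growth rate, the successor makes
    the sequence strictly increasing even while [block L n] is below [L]. *)
Fixpoint block L n : nat :=
  if n is m.+1 then ((block L m + block L m %/ L).+1)%N else 1%N.

Lemma block_gt0 L n : (0 < block L n)%N. Proof. by case: n. Qed.

Lemma block_lt L n : (block L n < block L n.+1)%N.
Proof. by rewrite ltnS leq_addr. Qed.

Lemma ltn_block L n : (n < block L n)%N.
Proof. by elim: n => // n ih; exact: leq_ltn_trans ih (block_lt L n). Qed.

Lemma block_le3 L n : (block L n.+1 <= 3 * block L n)%N.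
Proof.
rewrite /=; have := block_gt0 L n; have := leq_div (block L n) L; lia.
Qed.

Lemma block_gap L n : (0 < L)%N ->
  (block L n)%:R <= L%:R * ((block L n.+1)%:R - (block L n)%:R) :> R.
Proof.
move=> L0.
have h : (block L n <= block L n.+1)%N.
  have := block_lt L n.
  by apply: ltnW.
rewrite -natrB; last by [].
rewrite -natrM.
rewrite ler_nat.
have -> : (block L n.+1 - block L n = (block L n %/ L).+1)%N.
  by rewrite /= -addnS addKn.
by rewrite mulnC ltnW// ltn_ceil.
Qed.

Lemma block_ratio L n : (0 < L)%N -> (L <= block L n)%N ->
  (block L n.+1)%:R <= (1 + 2 / L%:R) * (block L n)%:R :> R.
Proof.
move=> L0 Lb; have L0' : 0 < L%:R :> R by rewrite ltr0n.
rewrite -(ler_pM2l L0') mulrA mulrDr mulr1 mulrCA divff ?gt_eqF// mulr1.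
rewrite -natrM -natrD -natrM ler_nat /= mulnS mulnDr mulnDl.
by have := leq_divM (block L n) L; lia.
Qed.

(** Write b, b' for consecutive blocks. From b <= L (b' - b) and b' <= 3b follows 1/b <= 3L (1/b -
    1/b'), so the series telescopes. Replacing b by max(u, b) in [a] keeps the increments
    nonnegative while b < u and bounds the initial value by 1/u. *)
Lemma sum_block_trunc L u N : (0 < L)%N -> 0 <= u ->
  \sum_(n < N) (u ^+ 2 * (u <= (block L n)%:R)%R%:R / (block L n)%:R)
    <= 3 * L%:R * u.
Proof.
move=> L0 u0; have [->|un0] := eqVneq u 0.
  by rewrite mulr0 big1// => i _; rewrite expr0n/= !mul0r.
have {u0 un0}u0 : 0 < u by rewrite lt_def un0.
have L0' : 0 < L%:R :> R by rewrite ltr0n.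
pose a n : R := (Num.max u (block L n)%:R)^-1.
have a_ge0 n : 0 <= a n by rewrite invr_ge0 le_max ltW.
suff H n : u ^+ 2 * (u <= (block L n)%:R)%R%:R / (block L n)%:R
    <= 3 * L%:R * u ^+ 2 * (a n - a n.+1).
  apply: (@le_trans _ _ (\sum_(n < N) 3 * L%:R * u ^+ 2 * (a n - a n.+1))).
    exact: ler_sum.
  rewrite -mulr_sumr -(big_mkord xpredT (fun n => a n - a n.+1)).
  have -> : \sum_(0 <= n < N) (a n - a n.+1) = a 0%N - a N.
    rewrite -opprB -telescope_sumr// -sumrN.
    by apply: eq_bigr => i _; rewrite opprB.
  rewrite expr2 !mulrA -mulrA ler_piMr//.
    by rewrite !mulr_ge0// ltW.
  apply: (@le_trans _ _ (u * a 0%N)); first by rewrite ler_pM2l// gerBl.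
  by rewrite ler_pdivrMr ?mul1r ?le_max ?lexx// lt_max u0.
have b0 : 0 < (block L n)%:R :> R by rewrite ltr0n block_gt0.
have b1 : 0 < (block L n.+1)%:R :> R by rewrite ltr0n block_gt0.
have bb : (block L n)%:R <= (block L n.+1)%:R :> R.
  by rewrite ler_nat ltnW// block_lt.
have [ub|ub] := leP u (block L n)%:R; last first.
  rewrite mulr0 mul0r mulr_ge0//; first by rewrite !mulr_ge0// ltW.
  rewrite subr_ge0 lef_pV2 ?posrE ?lt_max ?u0// ge_max !le_max lexx/=.
  by rewrite bb orbT.
rewrite mulr1 [3 * L%:R * _]mulrC -[X in _ <= X]mulrA ler_pM2l ?exprn_gt0//.
rewrite /a !max_r//; last exact: le_trans bb.
have := block_gap n L0; have : (block L n.+1)%:R <= 3 * (block L n)%:R :> R.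
  by rewrite -natrM ler_nat block_le3.
move: (block L n)%:R (block L n.+1)%:R b0 b1 bb {ub} => x y x0 y0 xy y3 gap.
have -> : x^-1 - y^-1 = (y - x) / (x * y) by field; rewrite !gt_eqF.
rewrite -[leLHS]mul1r mulrA ler_pdivlMr ?mulr_gt0//.
have -> : 1 / x * (x * y) = y by field; rewrite gt_eqF.
by nra.
Qed.

(** Telescopes through b <= L (b' - b). The cap 3u in [a] is not reached where a term is nonzero,
    since b < u forces b' <= 3b < 3u. *)
Lemma sum_block_tail L u N : (0 < L)%N -> 0 <= u ->
  \sum_(n < N) ((block L n)%:R * ((block L n)%:R < u)%R%:R) <= 3 * L%:R * u.
Proof.
move=> L0 u0.
have L0' : 0 < L%:R :> R by rewrite ltr0n.
pose a n : R := Num.min (3 * u) (block L n)%:R.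
suff H n : (block L n)%:R * ((block L n)%:R < u)%R%:R <= L%:R * (a n.+1 - a n).
  apply: (@le_trans _ _ (\sum_(n < N) L%:R * (a n.+1 - a n))).
    exact: ler_sum.
  rewrite -mulr_sumr -(big_mkord xpredT (fun n => a n.+1 - a n)).
  rewrite telescope_sumr// (mulrC 3) -mulrA ler_pM2l//.
  rewrite (@le_trans _ _ (a N))// ?gerBl ?le_min ?ge_min ?lexx//.
  by rewrite mulr_ge0//= ler0n.
have b0 : 0 < (block L n)%:R :> R by rewrite ltr0n block_gt0.
have bb : (block L n)%:R <= (block L n.+1)%:R :> R.
  by rewrite ler_nat ltnW// block_lt.
have [ub|ub] := leP u (block L n)%:R.
  rewrite mulr0; apply: mulr_ge0; first exact: ltW.
  by rewrite subr_ge0 /a le_min !ge_min lexx bb /= orbT.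
have h3 : (block L n.+1)%:R <= 3 * (block L n)%:R :> R.
  by rewrite -natrM ler_nat block_le3.
rewrite mulr1 /a !min_r; [exact: block_gap|lra|lra].
Qed.

End Blocks.

(** * From averages at block ends to all averages *)

(** Monotone sums place the average x = sm / m between the two block averages up to the factor 1 + 2
    dl. The upper side gives x <= (mu + dl)(1 + 2 dl) <= 3 (mu + 1); the lower side gives x >= mu -
    dl - 2 x dl, and 1 + 2 * 3 (mu + 1) is the constant 7 + 6 mu. *)
Lemma average_squeeze {R : realFieldType} (mu dl e b m b' s sm s' : R) :
  0 <= mu -> 0 < dl -> dl <= 1 -> (7 + 6 * mu) * dl <= e ->
  0 < b -> b <= m -> m <= b' -> b' <= (1 + 2 * dl) * b ->
  0 <= s -> s <= sm -> sm <= s' ->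
  `|mu - s / b| <= dl -> `|mu - s' / b'| <= dl -> `|mu - sm / m| <= e.
Proof.
move=> mu0 d0 d1 de b0 bm mb' b'b s0 ssm sms' h1 h2.
have m0 : 0 < m by exact: lt_le_trans bm.
have b'0 : 0 < b' by exact: lt_le_trans mb'.
have {h1}h1 : (mu - dl) * b <= s.
  by move: h1; rewrite ler_distlC => /andP[+ _]; rewrite ler_pdivlMr.
have {h2}h2 : s' <= (mu + dl) * b'.
  by move: h2; rewrite ler_distlC => /andP[_]; rewrite ler_pdivrMr.
have smE : sm = sm / m * m by rewrite divfK ?gt_eqF.
have x0 : 0 <= sm / m.
  by apply: divr_ge0; [exact: le_trans ssm|exact: ltW].
move: x0 smE; set x := sm / m => x0 smE.
have up : x <= (mu + dl) * (1 + 2 * dl).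
  rewrite -(ler_pM2r m0) -smE (le_trans sms')// (le_trans h2)// -mulrA ler_pM2l.
    by rewrite (le_trans b'b)// ler_pM2l//; lra.
  lra.
have lo : mu - dl <= x * (1 + 2 * dl).
  have [neg|pos] := leP (mu - dl) 0.
    by rewrite (le_trans neg)// mulr_ge0//; lra.
  rewrite -(ler_pM2r b0) -mulrA (le_trans h1)// (le_trans ssm)// smE.
  by apply: ler_wpM2l => //; exact: le_trans mb' _.
have dd : dl * dl <= dl by rewrite ler_piMr// ltW.
have md : mu * dl <= mu by rewrite ler_piMr.
have xd : x * dl <= 3 * (mu + 1) * dl by rewrite ler_pM2r//; nra.
by rewrite ler_norml; apply/andP; split; nra.
Qed.

(** For a fixed [L] the ratio of consecutive blocks does not tend to 1, so an error of order 1/L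
    remains; this is why convergence is assumed for every [L], which is then chosen from [e]. *)
Lemma cvg_block_average {R : realType} (S : nat -> R) (mu : R) :
  {homo S : n m / (n <= m)%N >-> n <= m} -> (forall n, 0 <= S n) ->
  (forall L, (0 < L)%N ->
     S (block L n) / (block L n)%:R @[n --> \oo] --> mu) ->
  S n / n%:R @[n --> \oo] --> mu.
Proof.
move=> ndS S0 SL.
have mu0 : 0 <= mu.
  rewrite -(cvg_lim _ (SL 1%N isT))//; apply: limr_ge.
    by apply/cvg_ex; exists mu; exact: SL.
  by apply: nearW => n; rewrite divr_ge0.
apply/cvgrPdist_le => e e0.
pose c := (7 + 6 * mu) / e.
have c0 : 0 < c by rewrite divr_gt0//; lra.
pose L := (Num.bound c).+1.
have L0 : 0 < L%:R :> R by rewrite ltr0n.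
have cL : c < L%:R.
  rewrite (lt_le_trans (archi_boundP (ltW c0)))// ler_nat.
  exact: leqnSn.
have dlt : (7 + 6 * mu) * L%:R^-1 <= e.
  by rewrite ler_pdivrMr// [e * _]mulrC -ler_pdivrMr// ltW.
have d1 : L%:R^-1 <= 1 :> R by rewrite invf_le1// ler1n.
have d0 : 0 < L%:R^-1 :> R by rewrite invr_gt0.
have := SL L isT; move/cvgrPdist_le => /(_ _ d0)[N0 _ HN].
(* The shift by [N0] gives the limit estimate, the shift by [L] gives [L <= block L n], as
   [block_ratio] demands. *)
exists (block L (N0 + L)) => // m /= Nm.
have [n [Nn bm mb]] : exists n, [/\ (N0 + L <= n)%N, (block L n <= m)%N &
    (m < block L n.+1)%N].
  have ex : exists n, (block L n <= m)%N by exists (N0 + L)%N.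
  have ub n : (block L n <= m)%N -> (n <= m)%N.
    by move=> h; rewrite ltnW// (leq_trans (ltn_block L n)).
  case: (ex_maxnP ex ub) => n bn maxn; exists n; split => //; first exact: maxn.
  by rewrite ltnNge; apply/negP => /maxn; rewrite ltnn.
have Lb : (L <= block L n)%N.
  by rewrite (leq_trans _ (ltnW (ltn_block L n)))// (leq_trans _ Nn) ?leq_addl.
have h1 : `|mu - S (block L n) / (block L n)%:R| <= L%:R^-1.
  by apply: HN => /=; exact: leq_trans (leq_addr _ _) Nn.
have h2 : `|mu - S (block L n.+1) / (block L n.+1)%:R| <= L%:R^-1.
  by apply: HN => /=; rewrite leqW// (leq_trans (leq_addr _ _) Nn).
have b0 : 0 < (block L n)%:R :> R by rewrite ltr0n block_gt0.
apply: (average_squeeze mu0 d0 d1 dlt b0 _ _ _ _ _ _ h1 h2) => //.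
- by rewrite ler_nat.
- by rewrite ler_nat ltnW.
- exact: block_ratio.
- exact: ndS.
- exact/ndS/ltnW.
Qed.

(** * Integrals of finite sums and almost sure convergence from summable expectations *)

Section FiniteSums.
Context {d : measure_display} {Omega : measurableType d} {R : realType}
  (mu : {measure set Omega -> \bar R}) (D : set Omega) (mD : measurable D).

Lemma integrable_sumR (I : Type) (s : seq I) (f : I -> Omega -> R) :
  (forall i, mu.-integrable D (EFin \o f i)) ->
  mu.-integrable D (EFin \o (fun w => \sum_(i <- s) f i w)).
Proof.
move=> fi; apply: (@eq_integrable _ _ _ mu D mD
  (fun w => \sum_(i <- s) (f i w)%:E)%E); first by move=> w _ /=; rewrite sumEFin.
by apply: (integrable_sum mD) => i _; exact: fi.
Qed.

Lemma Rintegral_sum (I : Type) (s : seq I) (f : I -> Omega -> R) :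
  (forall i, mu.-integrable D (EFin \o f i)) ->
  \int[mu]_(w in D) (\sum_(i <- s) f i w) = \sum_(i <- s) \int[mu]_(w in D) f i w.
Proof.
move=> fi; elim: s => [|i s ih].
  rewrite big_nil -[RHS](mul0r (fine (mu D))) -Rintegral_cst//.
  by apply: eq_Rintegral => w _; rewrite big_nil.
rewrite big_cons -ih -RintegralD//; last exact: integrable_sumR.
by apply: eq_Rintegral => w _; rewrite big_cons.
Qed.

End FiniteSums.

Section SummableAE.
Context {d : measure_display} {Omega : measurableType d} {R : realType}
  (mu : {measure set Omega -> \bar R}).

(** Does the work of Chebyshev and Borel-Cantelli together: by monotone convergence the series of
    the [W n] has a finite integral, so it is finite almost everywhere and its terms vanish in the
    limit. *)
Lemma ae_cvg0_summable (W : nat -> Omega -> R) (C : R) :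
  (forall n w, 0 <= W n w) ->
  (forall n, mu.-integrable setT (EFin \o W n)) ->
  (forall N, \sum_(n < N) \int[mu]_w W n w <= C) ->
  {ae mu, forall w, W n w @[n --> \oo] --> 0}.
Proof.
move=> W0 iW WC.
have mW n : measurable_fun setT (EFin \o W n) by case/integrableP : (iW n).
have mS : measurable_fun setT (fun w => \sum_(n <oo) (W n w)%:E)%E.
  by apply: ge0_emeasurable_sum => [n w _ _|n _]; rewrite ?lee_fin; [exact: W0|exact: mW].
have iW0 n : (0 <= \int[mu]_w (W n w)%:E)%E.
  by apply: integral_ge0 => w _; rewrite lee_fin.
have S0 w : (0 <= \sum_(n <oo) (W n w)%:E)%E.
  by apply: nneseries_ge0 => n _ _; rewrite lee_fin.
have iS : mu.-integrable setT (fun w => \sum_(n <oo) (W n w)%:E)%E.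
  apply/integrableP; split => //.
  under eq_integral do rewrite gee0_abs//.
  rewrite integral_nneseries//; last by move=> n w _; rewrite lee_fin.
  apply: (@le_lt_trans _ _ C%:E); last exact: ltry.
  apply: lime_le.
    by apply: is_cvg_nneseries => n _ _.
  apply: nearW => N; rewrite big_mkord.
  rewrite (le_trans _ (_ : (\sum_(n < N) \int[mu]_w W n w)%:E <= _)%E) ?lee_fin//.
  rewrite -sumEFin; apply: lee_sum => n _.
  by rewrite /Rintegral (fineK (integrable_fin_num measurableT (iW n))).
apply: filterS (integrable_ae measurableT iS) => w /(_ I) fw.
apply: cvg_series_cvg_0; apply: nondecreasing_is_cvgn.
  by apply: nondecreasing_series => n _ _; exact: W0.
exists (fine (\sum_(n <oo) (W n w)%:E)%E) => _ [N _ <-].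
rewrite -lee_fin fineK// /series/= -sumEFin.
by apply: nneseries_lim_ge => n _; rewrite lee_fin.
Qed.

End SummableAE.

(** * Etemadi's strong law for nonnegative, pairwise independent, identically distributed
    variables *)

Section StrongLaw.
Context {d : measure_display} {Omega : measurableType d} {R : realType}
  (P : probability Omega R).

Definition trunc (c x : R) : R := x * (x <= c)%R%:R.

Lemma measurable_trunc c : measurable_fun setT (trunc c).
Proof.
apply: measurable_funM => //.
rewrite (_ : (fun x => (x <= c)%R%:R) = \1_`]-oo, c]%classic).
  by apply: measurable_indic; exact: measurable_itv.
by apply/funext => x; rewrite indicE mem_setE in_itv.
Qed.

Lemma truncN_bounds c x : 0 <= c -> 0 <= x -> 0 <= trunc c x <= c.
Proof.
move=> c0 x0; rewrite /trunc; case: (leP x c) => xc /=.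
  by rewrite mulr1 x0.
by rewrite mulr0 lexx.
Qed.

Lemma norm_bounded (f : Omega -> R) (M : R) :
  (forall w, `|f w| <= M) -> [bounded f x | x in setT].
Proof.
move=> fM; exists M; split; first exact: num_real.
by move=> x Mx w _ /=; rewrite (le_trans (fM w))// ltW.
Qed.

Lemma Rintegral_probability_cst (r : R) : \int[P]_w r = r.
Proof. by rewrite Rintegral_cst// [X in fine X]probability_setT mulr1. Qed.

Lemma Rintegral_ident (U V : Omega -> R) (h : R -> R) :
  measurable_fun setT U -> measurable_fun setT V ->
  (forall A, measurable A -> P (U @^-1` A) = P (V @^-1` A)) ->
  measurable_fun setT h ->
  P.-integrable setT (EFin \o (h \o U)) -> P.-integrable setT (EFin \o (h \o V)) ->
  \int[P]_w h (U w) = \int[P]_w h (V w).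
Proof.
move=> mU mV UV mh iU iV; rewrite /Rintegral; congr fine.
have mEh : measurable_fun setT (EFin \o h) by exact/measurable_EFinP.
have := integral_pushforward mU mEh iU measurableT.
have := integral_pushforward mV mEh iV measurableT.
rewrite !preimage_setT => <- <-.
by apply: eq_measure_integral => A mA _; exact: UV.
Qed.

Variable U : nat -> Omega -> R.
Hypothesis mU : forall i, measurable_fun setT (U i).
Hypothesis identU : forall i A, measurable A -> P (U i @^-1` A) = P (U 0%N @^-1` A).
Hypothesis indepU : forall i j, i != j -> independent_rv P (U i) (U j).

Section Nonnegative.
Hypothesis U0 : forall i w, 0 <= U i w.
Hypothesis intU : P.-integrable setT (EFin \o U 0%N).

(** Variance of a sum: the off-diagonal terms of the expanded square vanish by pairwise independence
    of the centred variables, and each variance is at most the second moment. *)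
Lemma second_moment_trunc_sum (c : R) (k : nat) : 0 <= c ->
  \int[P]_w ((\sum_(i < k) trunc c (U i w)) -
     k%:R * \int[P]_w trunc c (U 0%N w)) ^+ 2
  <= k%:R * \int[P]_w (trunc c (U 0%N w)) ^+ 2.
Proof.
move=> c0; set m := \int[P]_w trunc c (U 0%N w).
have mT i : measurable_fun setT (trunc c \o U i).
  by apply: measurableT_comp => //; exact: measurable_trunc.
have Tb i w : `|trunc c (U i w)| <= c.
  by have /andP[? ?] := truncN_bounds c0 (U0 i w); rewrite ger0_norm.
have iT i : P.-integrable setT (EFin \o (trunc c \o U i)).
  by apply: bounded_probability_integrable => //; exact: norm_bounded (Tb i).
have Em i : \int[P]_w trunc c (U i w) = m.
  by apply: (@Rintegral_ident _ _ (trunc c)) => //; [exact: identU|exact: measurable_trunc].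
pose v i w := trunc c (U i w) - m.
have mv i : measurable_fun setT (v i) by apply: measurable_funB => //; exact: mT.
have vb i w : `|v i w| <= c + `|m| by rewrite (le_trans (ler_normB _ _))// lerD2r.
have bv i : [bounded v i w | w in setT] by exact: norm_bounded (vb i).
have Ev i : \int[P]_w v i w = 0.
  rewrite RintegralB//; last 2 first.
  - exact: iT.
  - exact: finite_measure_integrable_cst.
  by rewrite Em Rintegral_probability_cst subrr.
have Evv i j : i != j -> \int[P]_w (v i w * v j w) = 0.
  move=> ij; rewrite Rintegral_indepM ?Ev ?mul0r //. 
  apply: (@independent_comp _ _ _ _ _ _ (fun x => trunc c x - m) (fun x => trunc c x - m)).
  - by apply: measurable_funB => //; exact: measurable_trunc.
  - by apply: measurable_funB => //; exact: measurable_trunc.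
  - exact: indepU.
have ivv i j : P.-integrable setT (EFin \o (fun w => v i w * v j w)).
  apply: bounded_probability_integrable; first exact: measurable_funM.
  apply: (@norm_bounded _ ((c + `|m|) * (c + `|m|))) => w.
  by rewrite normrM ler_pM.
have iTT j : P.-integrable setT (EFin \o (fun w => trunc c (U j w) ^+ 2)).
  apply: bounded_probability_integrable; first by apply: measurable_funX; exact: mT.
  apply: (@norm_bounded _ (c * c)) => w.
  by rewrite normrX expr2 ler_pM.
have E2 j : \int[P]_w (trunc c (U j w) ^+ 2) = \int[P]_w (trunc c (U 0%N w) ^+ 2).
  apply: (@Rintegral_ident _ _ (fun x => trunc c x ^+ 2)) => //.
  - exact: identU.
  - by apply: measurable_funX; exact: measurable_trunc.
  - exact: iTT.
  - exact: iTT.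
have Ev2 i : \int[P]_w (v i w * v i w) <= \int[P]_w (trunc c (U 0%N w) ^+ 2).
  have -> : \int[P]_w (v i w * v i w) =
      \int[P]_w (trunc c (U i w) ^+ 2 - (2 * m * trunc c (U i w) - m ^+ 2)).
    by apply: eq_Rintegral => w _; rewrite /v; ring.
  have i2 : P.-integrable setT (EFin \o (fun w => 2 * m * trunc c (U i w))).
    exact: (integrableZl measurableT (2 * m) (iT i)).
  have im : P.-integrable setT (EFin \o (fun w => m ^+ 2)).
    exact: finite_measure_integrable_cst.
  rewrite RintegralB//; last exact: (integrableB measurableT i2 im).
  rewrite RintegralB// RintegralZl//; last exact: iT.
  rewrite Em Rintegral_probability_cst E2 lerBlDr lerDl; nra.
have sqE w : ((\sum_(i < k) trunc c (U i w)) - k%:R * m) ^+ 2 =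
    \sum_(i < k) \sum_(j < k) v i w * v j w.
  rewrite mulr_natl -[in m *+ k](card_ord k) -sumr_const -sumrB expr2 mulr_suml.
  by apply: eq_bigr => i _; rewrite mulr_sumr.
under eq_Rintegral do rewrite sqE.
rewrite Rintegral_sum//; last first.
  by move=> i; apply: (integrable_sumR measurableT) => j; exact: ivv.
have -> : k%:R * \int[P]_w (trunc c (U 0%N w) ^+ 2) =
    \sum_(i < k) \int[P]_w (trunc c (U 0%N w) ^+ 2).
  by rewrite sumr_const card_ord mulr_natl.
apply: ler_sum => i _; rewrite Rintegral_sum//.
rewrite (bigD1 i)//= big1 ?addr0; first exact: Ev2.
by move=> j ji; apply: Evv; rewrite eq_sym.
Qed.

Lemma cvg_trunc_mean (c : nat -> R) : (forall n, n%:R <= c n) ->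
  \int[P]_w trunc (c n) (U 0%N w) @[n --> \oo] --> \int[P]_w U 0%N w.
Proof.
move=> nc; apply: fine_cvg; rewrite fineK; last exact: integrable_fin_num.
apply: (@dominated_cvg _ _ _ P setT measurableT
    (fun n w => (trunc (c n) (U 0%N w))%:E) _ (EFin \o U 0%N)) => //.
- move=> n; apply/measurable_EFinP.
  by apply: measurableT_comp => //; exact: measurable_trunc.
- move=> w _; apply: cvg_near_cst.
  exists (Num.bound (U 0%N w)) => // n /= bn.
  rewrite /trunc (_ : (U 0%N w <= c n) = true) ?mulr1//.
  rewrite (le_trans _ (nc n))// (le_trans (ltW (archi_boundP (U0 _ _))))//.
  by rewrite ler_nat.
- move=> n w _ /=; rewrite lee_fin ger0_norm /trunc ?mulr_ge0//.
  by case: (U 0%N w <= c n)%R; rewrite /= ?mulr1 ?mulr0.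
Qed.

(** All variables of a block are truncated at the same level, the block length, so the truncated
    ones stay identically distributed. Their mean [m n] tends to [mu]; the centred sum [V n] over
    the block length tends to 0, and [J n], the number of truncated variables, is eventually 0. *)
Lemma strong_law_block L : (0 < L)%N ->
  {ae P, forall w, (\sum_(i < block L n) U i w) / (block L n)%:R @[n --> \oo] -->
     \int[P]_w U 0%N w}.
Proof.
move=> L0; set mu := \int[P]_w U 0%N w.
pose k n : R := (block L n)%:R.
have k0 n : 0 < k n by rewrite ltr0n block_gt0.
have k_ge0 n := ltW (k0 n).
pose m n := \int[P]_w trunc (k n) (U 0%N w).
pose V n w := (\sum_(i < block L n) trunc (k n) (U i w)) - k n * m n.
pose J n w : R := \sum_(i < block L n) (k n < U i w)%R%:R.
have mT c i : measurable_fun setT (fun w => trunc c (U i w)).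
  by apply: (measurableT_comp (measurable_trunc c)).
have mh c : measurable_fun setT (fun x : R => (c < x)%R%:R : R).
  rewrite (_ : (fun _ => _) = (\1_`]c, +oo[%classic : R -> R)).
    by apply: measurable_indic; exact: measurable_itv.
  by apply/funext => x /=; rewrite indicE mem_setE in_itv/= andbT.
have mI c i : measurable_fun setT (fun w => (c < U i w)%R%:R : R).
  exact: (measurableT_comp (mh c) (mU i)).
have iI c i : P.-integrable setT (EFin \o (fun w => (c < U i w)%R%:R : R)).
  apply: bounded_probability_integrable => //; apply: (@norm_bounded _ 1) => w.
  by case: (c < U i w)%R; rewrite ?normr1 ?normr0.
have Tb n i w : `|trunc (k n) (U i w)| <= k n.
  by have /andP[? ?] := truncN_bounds (k_ge0 n) (U0 i w); rewrite ger0_norm.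
have iT2 n : P.-integrable setT (EFin \o (fun w => trunc (k n) (U 0%N w) ^+ 2)).
  apply: bounded_probability_integrable; first by apply: measurable_funX; exact: mT.
  by apply: (@norm_bounded _ (k n * k n)) => w; rewrite normrX expr2 ler_pM.
have iV2 n : P.-integrable setT (EFin \o (fun w => V n w ^+ 2)).
  apply: bounded_probability_integrable.
    apply: measurable_funX; apply: measurable_funB => //.
    by apply: measurable_sum => i; exact: mT.
  pose B := (block L n)%:R * k n + `|k n * m n|.
  apply: (@norm_bounded _ (B * B)) => w; rewrite normrX expr2.
  suff h : `|V n w| <= B by rewrite ler_pM.
  rewrite (le_trans (ler_normB _ _))// lerD2r (le_trans (ler_norm_sum _ _ _))//.
  rewrite mulr_natl -[in leRHS](card_ord (block L n)) -sumr_const.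
  exact: ler_sum.
have iJ n : P.-integrable setT (EFin \o J n).
  by apply: (integrable_sumR measurableT) => i; exact: iI.
(* One nonnegative quantity carries both error sources, so a single summability argument settles
   them. *)
pose W n w := (k n) ^- 2 * V n w ^+ 2 + J n w.
have iW1 n : P.-integrable setT (EFin \o (fun w => (k n) ^- 2 * V n w ^+ 2)).
  exact: (integrableZl measurableT _ (iV2 n)).
have iW n : P.-integrable setT (EFin \o W n).
  exact: (integrableD measurableT (iW1 n) (iJ n)).
have J0 n w : 0 <= J n w by apply: sumr_ge0.
have W0 n w : 0 <= W n w.
  by rewrite addr_ge0// mulr_ge0 ?sqr_ge0// invr_ge0 exprn_ge0.
(* E(W n) is at most E(G n (U 0)), and summing [G n u] over n gives the two telescoping block sums,
   each at most 3 L u; hence the 6 L below. *)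
pose G n u : R := u ^+ 2 * (u <= k n)%R%:R / k n + k n * (k n < u)%R%:R.
have G1 n w : U 0%N w ^+ 2 * (U 0%N w <= k n)%R%:R / k n =
    (k n)^-1 * trunc (k n) (U 0%N w) ^+ 2.
  rewrite /trunc mulrC exprMn; congr (_ * (_ * _)).
  by case: (U 0%N w <= k n)%R; rewrite /= ?expr1n// expr0n.
have iG1 n : P.-integrable setT
    (EFin \o (fun w => (k n)^-1 * trunc (k n) (U 0%N w) ^+ 2)).
  exact: (integrableZl measurableT _ (iT2 n)).
have iG2 n : P.-integrable setT
    (EFin \o (fun w => k n * (k n < U 0%N w)%R%:R)).
  exact: (integrableZl measurableT _ (iI (k n) 0%N)).
have iG n : P.-integrable setT (EFin \o (G n \o U 0%N)).
  rewrite (_ : G n \o U 0%N = fun w => (k n)^-1 * trunc (k n) (U 0%N w) ^+ 2 +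
    k n * (k n < U 0%N w)%R%:R).
    exact: (integrableD measurableT (iG1 n) (iG2 n)).
  by apply/funext => w; rewrite /G /= G1.
have WG n : \int[P]_w W n w <= \int[P]_w G n (U 0%N w).
  rewrite RintegralD//.
  rewrite RintegralZl// /G.
  under [leRHS]eq_Rintegral do rewrite G1.
  rewrite RintegralD// RintegralZl// RintegralZl//.
  apply: lerD.
    rewrite -[leRHS](mulKf (_ : k n ^+ 2 != 0)); last by rewrite expf_neq0// gt_eqF.
    rewrite ler_pM2l ?invr_gt0 ?exprn_gt0// expr2 -mulrA mulVKf ?gt_eqF//.
    exact: second_moment_trunc_sum.
  rewrite Rintegral_sum//.
  rewrite mulr_natl -[in leRHS](card_ord (block L n)) -sumr_const ler_sum// => i _.
  rewrite le_eqVlt; apply/orP; left; apply/eqP.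
  apply: (@Rintegral_ident _ _ (fun x : R => (k n < x)%R%:R)) => //.
  - exact: identU.
  - exact: iI.
  - exact: iI.
have sumG N : \sum_(n < N) \int[P]_w W n w <= 6 * L%:R * mu.
  apply: (@le_trans _ _ (\sum_(n < N) \int[P]_w G n (U 0%N w))).
    by apply: ler_sum => n _; exact: WG.
  rewrite -Rintegral_sum//; last by move=> i; exact: iG.
  have -> : 6 * L%:R * mu = \int[P]_w (6 * L%:R * U 0%N w) by rewrite RintegralZl.
  apply: le_Rintegral => //.
  - by apply: (integrable_sumR measurableT) => i; exact: iG.
  - exact: (integrableZl measurableT _ intU).
  - move=> w _; rewrite big_split/=.
    have -> : 6 * L%:R * U 0%N w = 3 * L%:R * U 0%N w + 3 * L%:R * U 0%N w by ring.
    by apply: lerD; [exact: sum_block_trunc|exact: sum_block_tail].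
apply: filterS (ae_cvg0_summable W0 iW sumG) => w Ww.
have cm : m n @[n --> \oo] --> mu.
  by apply: cvg_trunc_mean => n; rewrite ler_nat ltnW// ltn_block.
apply/cvgrPdist_le => e e0.
have e20 : 0 < e / 2 by rewrite divr_gt0.
move/cvgrPdist_le : cm => /(_ _ e20) cm.
(* Below 1/2 the count [J n] can only be 0, so truncation changes nothing; (e/2)^2 bounds the square
   of [V n w / k n]. *)
have e2 : 0 < Num.min (1 / 2) ((e / 2) ^+ 2) by rewrite lt_min exprn_gt0// divr_gt0.
move/cvgrPdist_le : Ww => /(_ _ e2) Ww.
near=> n.
have h1 : `|mu - m n| <= e / 2 by near: n.
have : `|0 - W n w| <= Num.min (1 / 2) ((e / 2) ^+ 2) by near: n.
rewrite sub0r normrN ger0_norm// le_min => /andP[Wh We].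
have VW : (k n) ^- 2 * V n w ^+ 2 <= W n w by rewrite lerDl.
have JW : J n w <= W n w by rewrite lerDr mulr_ge0 ?sqr_ge0// invr_ge0 exprn_ge0.
have ST : \sum_(i < block L n) U i w = \sum_(i < block L n) trunc (k n) (U i w).
  apply: eq_bigr => i _; rewrite /trunc.
  have [|kU] := leP (U i w) (k n); first by rewrite mulr1.
  suff : 1 <= J n w by move=> ?; lra.
  rewrite /J (bigD1 i)//= kU lerDl; exact: sumr_ge0.
have h2 : `|V n w / k n| <= e / 2.
  rewrite -(@ler_pXn2r _ 2)// ?nnegrE ?(ltW e20)// -normrX ger0_norm ?sqr_ge0//.
  by rewrite (le_trans _ We)// (le_trans _ VW)// expr_div_n mulrC.
rewrite ST -/(k n).
have -> : mu - (\sum_(i < block L n) trunc (k n) (U i w)) / k n =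
    (mu - m n) - V n w / k n.
  by rewrite /V mulrBl mulrAC divff ?gt_eqF//; ring.
by rewrite (le_trans (ler_normB _ _))// (splitr e) lerD.
Unshelve. all: by end_near. Qed.

Lemma strong_law_ge0 :
  {ae P, forall w, (\sum_(i < n) U i w) / n%:R @[n --> \oo] --> \int[P]_w U 0%N w}.
Proof.
have : {ae P, forall w L,
    (\sum_(i < block L.+1 n) U i w) / (block L.+1 n)%:R @[n --> \oo] -->
     \int[P]_w U 0%N w}.
  by apply: ae_foralln => L; exact: strong_law_block.
apply: filterS => w slln.
apply: (@cvg_block_average R (fun n => \sum_(i < n) U i w)).
- move=> n m nm; rewrite -!(big_mkord xpredT (fun i => U i w)).
  by rewrite (big_cat_nat (leq0n n) nm)//= lerDl sumr_ge0.
- by move=> n; exact: sumr_ge0.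
- by move=> [//|L] _; exact: slln.
Qed.

End Nonnegative.
End StrongLaw.

(** * The strong law for integrable functions of an i.i.d. sequence *)

Section PairIndependence.
Import finmap.

Lemma mutually_independent_pair {d d' : measure_display}
    {Omega : measurableType d} {T : measurableType d'} {R : realType}
    (P : probability Omega R) (Z : nat -> Omega -> T) (i j : nat) (A B : set T) :
  mutually_independent P Z -> i != j -> measurable A -> measurable B ->
  P (Z i @^-1` A `&` Z j @^-1` B) = (P (Z i @^-1` A) * P (Z j @^-1` B))%E.
Proof.
move=> indZ ij mA mB.
have mAB k : measurable (if k == i then A else B) by case: ifP.
have := indZ [fset i; j]%fset _ mAB.
rewrite big_fsetU1 ?inE//= big_seq_fset1 eqxx eq_sym (negbTE ij) => <-.
congr (P _); apply/seteqP; split => [w [? ?] k /=|w h].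
  by rewrite !inE => /orP[] /eqP ->; rewrite ?eqxx// eq_sym (negbTE ij).
split.
  by have := h i; rewrite /= !inE eqxx /=; apply.
by have := h j; rewrite /= !inE eqxx orbT eq_sym (negbTE ij) /=; apply.
Qed.

End PairIndependence.

(** Positive and negative parts are treated separately because passing from blocks to all indices
    needs monotone partial sums. *)
Lemma strong_law {d d' : measure_display} {Omega : measurableType d}
    {T : measurableType d'} {R : realType} (P : probability Omega R)
    (Z : nat -> Omega -> T) (phi : T -> R) :
  iid P Z -> measurable_fun setT phi ->
  P.-integrable setT (EFin \o (phi \o Z 0%N)) ->
  {ae P, forall w, n.+1%:R^-1 * \sum_(i < n.+1) phi (Z i w) @[n --> \oo] -->
     \int[P]_w phi (Z 0%N w)}.
Proof.
move=> [mZ idZ indZ] mphi iphi.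
have SL (psi : T -> R) : measurable_fun setT psi -> (forall t, 0 <= psi t) ->
    P.-integrable setT (EFin \o (psi \o Z 0%N)) ->
    {ae P, forall w, (\sum_(i < n) psi (Z i w)) / n%:R @[n --> \oo] -->
     \int[P]_w psi (Z 0%N w)}.
  move=> mpsi psi0 ipsi.
  have mpre A : measurable A -> measurable (psi @^-1` A).
    by move=> mA; have := mpsi measurableT A mA; rewrite setTI.
  apply: (@strong_law_ge0 _ _ _ P (fun i w => psi (Z i w))) => //.
  - by move=> i; exact: (measurableT_comp mpsi).
  - by move=> i A mA; exact: (idZ i 0%N _ (mpre _ mA)).
  - move=> i j ij A B mA mB.
    exact: (mutually_independent_pair indZ ij (mpre _ mA) (mpre _ mB)).
have mp := measurable_funrpos mphi; have mn := measurable_funrneg mphi.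
have ip := integrable_funrpos measurableT iphi.
have im := integrable_funrneg measurableT iphi.
have := SL _ mp (funrpos_ge0 phi) ip; have := SL _ mn (funrneg_ge0 phi) im.
apply: filterS2 => w cn cp.
have pn t : phi t = phi^\+ t - phi^\- t by rewrite -[in LHS](funrposBneg phi).
have -> : \int[P]_w phi (Z 0%N w) =
    \int[P]_w phi^\+ (Z 0%N w) - \int[P]_w phi^\- (Z 0%N w).
  by rewrite -RintegralB//; apply: eq_Rintegral => v _; exact: pn.
(* Averages over n + 1 terms are the shift of averages over n terms; at n = 0 the latter take the
   default value 0. *)
rewrite (@cvg_shiftS _ (fun n => n%:R^-1 * \sum_(i < n) phi (Z i w))).
rewrite (_ : (fun n => _) = (fun n => (\sum_(i < n) phi^\+ (Z i w)) / n%:R -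
    (\sum_(i < n) phi^\- (Z i w)) / n%:R)); first exact: cvgB cp cn.
apply/funext => n; rewrite mulrC -mulrBl -sumrB; congr (_ * _).
by apply: eq_bigr => i _; exact: pn.
Qed.

(** * Derivatives, convexity and strict positivity of the variance in the exponential family *)

Section ExpFamily.
Context {R : realType} {d : nat}.
Variables (lambda : {measure set (borelRV R d) -> \bar R})
  (Y : set (borelRV R d)) (s : borelRV R d -> R).
Hypothesis mY : measurable Y.
Hypothesis ms : measurable_fun Y s.
Local Notation N := (natural_parameters lambda Y s).
Hypothesis oN : open N.

(** For eta in N, the k-th derivative of the partition function [exp_moment 0]. *)
Definition exp_moment (k : nat) (eta : R) : R :=
  \int[lambda]_(y in Y) (s y ^+ k * expR (eta * s y)).

Local Notation M := exp_moment.

Let mexp k (eta : R) : measurable_fun Y (fun y => s y ^+ k * expR (eta * s y)).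
Proof.
apply: measurable_funM; first exact: measurable_funX.
by apply: measurableT_comp => //; exact: measurable_funM.
Qed.

(** [lne] sends 0 to -oo and +oo to +oo, so a finite log-partition excludes a vanishing integral as
    well as an infinite one. *)
Lemma natural_parametersP (eta : R) : N eta ->
  [/\ lambda.-integrable Y (EFin \o (fun y => expR (eta * s y))),
      0 < M 0 eta & kappa lambda Y s eta = ln (M 0 eta)].
Proof.
rewrite /natural_parameters /kappa /log_partition /M /Rintegral /=.
under [in X in _ -> X]eq_integral do rewrite expr0 mul1r.
have I0 : (0 <= \int[lambda]_(y in Y) (expR (eta * s y))%:E)%E.
  by apply: integral_ge0 => y _; rewrite lee_fin expR_ge0.
have iE : (\int[lambda]_(y in Y) (expR (eta * s y))%:E < +oo)%E ->
    lambda.-integrable Y (EFin \o (fun y => expR (eta * s y))).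
  move=> fin; apply/integrableP; split.
    by apply/measurable_EFinP; apply: measurableT_comp => //; exact: measurable_funM.
  by under eq_integral do rewrite /= ger0_norm ?expR_ge0//.
move: I0 iE; case: (\int[lambda]_(y in Y) _)%E => [r| |] //= r0 iE.
by case: (leP r 0%R) => //= r1 _; split => //; apply: iE; exact: ltry.
Qed.

Let nbhs_N (eta : R) : N eta -> exists2 e : R, 0 < e &
  forall x, `|x - eta| <= e -> N x.
Proof.
move=> Neta; have /nbhs_ballP[e /= e0 He] := open_nbhs_nbhs (conj oN Neta).
exists (e / 2) => [|x xe]; first exact: divr_gt0.
by apply: He; rewrite /ball /= distrC (le_lt_trans xe)//; lra.
Qed.

(** According to the sign of x, one end of the interval around eta maximises the exponential. The
    right side is free of z, which makes it the envelope for differentiating [exp_moment] under the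
    integral. *)
Lemma norm_expR_bound (k : nat) (eta e x z : R) : 0 < e -> `|z - eta| <= e ->
  `|x ^+ k * expR (z * x)| <=
    `|x| ^+ k * (expR ((eta + e) * x) + expR ((eta - e) * x)).
Proof.
move=> e0; rewrite ler_distl => /andP[h1 h2].
rewrite normrM normrX (ger0_norm (expR_ge0 _)) ler_wpM2l//.
have [x0|x0] := leP 0 x.
  have : expR (z * x) <= expR ((eta + e) * x) by rewrite ler_expR ler_wpM2r.
  by have := expR_ge0 ((eta - e) * x); lra.
have : expR (z * x) <= expR ((eta - e) * x) by rewrite ler_expR ler_wnM2r// ltW.
by have := expR_ge0 ((eta + e) * x); lra.
Qed.

(** Each further factor of s is paid for by |e s| <= exp(e s) + exp(-e s), which moves eta to eta +
    e and eta - e; these stay in N because N is open. *)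
Lemma exp_moment_integrable k (eta : R) : N eta ->
  lambda.-integrable Y (EFin \o (fun y => s y ^+ k * expR (eta * s y))).
Proof.
elim: k eta => [|k ih] eta Neta.
  have [+ _ _] := natural_parametersP Neta; apply: eq_integrable => // y _ /=.
  by rewrite expr0 mul1r.
have [e e0 eN] := nbhs_N Neta.
have N1 : N (eta + e) by apply: eN; rewrite addrAC subrr add0r gtr0_norm.
have N2 : N (eta - e) by apply: eN; rewrite addrAC subrr add0r normrN gtr0_norm.
have i1 := integrable_norm (ih _ N1); have i2 := integrable_norm (ih _ N2).
have i3 := integrableZl mY e^-1 (integrableD mY i1 i2).
apply: (le_integrable mY _ _ i3); first by apply/measurable_EFinP; exact: mexp.
move=> y _ /=; rewrite lee_fin [leRHS]ger0_norm; last first.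
  by apply: mulr_ge0; [rewrite invr_ge0 ltW|exact: addr_ge0].
have h : `|s y * e| <= expR (e * s y) + expR (- e * s y).
  have h1 := expR_ge1Dx (e * s y); have h2 := expR_ge1Dx (- e * s y).
  have h3 := expR_ge0 (e * s y); have h4 := expR_ge0 (- e * s y).
  by rewrite ler_norml; apply/andP; split; lra.
rewrite ler_pdivlMl// !normrM !normrX !(ger0_norm (expR_ge0 _)) exprS.
have -> : `|s y| ^+ k * expR ((eta + e) * s y) + `|s y| ^+ k * expR ((eta - e) * s y)
    = (`|s y| ^+ k * expR (eta * s y)) * (expR (e * s y) + expR (- e * s y)).
  by rewrite !mulrDl !expRD; ring.
have -> : e * (`|s y| * `|s y| ^+ k * expR (eta * s y)) =
    (`|s y| ^+ k * expR (eta * s y)) * (`|s y| * `|e|).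
  by rewrite (gtr0_norm e0); ring.
by rewrite -normrM ler_wpM2l// mulr_ge0 ?expR_ge0.
Qed.

Lemma is_derive_exp_moment k (eta : R) : N eta ->
  is_derive eta 1 (M k) (M k.+1 eta).
Proof.
move=> Neta; have [e e0 eN] := nbhs_N Neta.
have N1 : N (eta + e) by apply: eN; rewrite addrAC subrr add0r gtr0_norm.
have N2 : N (eta - e) by apply: eN; rewrite addrAC subrr add0r normrN gtr0_norm.
pose f (x : R) y := s y ^+ k * expR (x * s y).
have dfE (x : R) y : is_derive x 1 (f ^~ y) (s y ^+ k.+1 * expR (x * s y)).
  have -> : f ^~ y = s y ^+ k \*: (expR \o (id * cst (s y))) by apply/funext.
  apply: is_derive_eq; rewrite /= !fctE /=.
  by rewrite /GRing.scale /= mulr0 add0r mulr1 exprSr; ring.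
have df1 x y : partial1of2 f x y = s y ^+ k.+1 * expR (x * s y).
  by rewrite partial1of2E; apply: derive_val.
pose G y := `|s y| ^+ k.+1 * (expR ((eta + e) * s y) + expR ((eta - e) * s y)).
have G0 y : 0 <= G y by rewrite mulr_ge0 ?addr_ge0 ?expR_ge0.
have iG : lambda.-integrable Y (EFin \o G).
  have i1 := integrable_norm (exp_moment_integrable k.+1 N1).
  have i2 := integrable_norm (exp_moment_integrable k.+1 N2).
  apply: eq_integrable (integrableD mY i1 i2) => // y _ /=.
  by rewrite /G mulrDr !normrM !normrX !(ger0_norm (expR_ge0 _)).
have near_e x : `]eta - e, eta + e[%classic x -> `|x - eta| <= e.
  by rewrite /= in_itv/= ler_distl => /andP[h1 h2]; rewrite !ltW.
have etaI : `]eta - e, eta + e[%classic eta.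
  by rewrite /= in_itv/=; apply/andP; split; lra.
have intf x : `]eta - e, eta + e[%classic x -> lambda.-integrable Y (EFin \o f x).
  by move=> xI; apply: exp_moment_integrable; exact/eN/near_e.
have derf x y : `]eta - e, eta + e[%classic x -> Y y -> derivable (f ^~ y) x 1.
  by move=> _ _; apply: ex_derive; exact: dfE.
have Gub x y : `]eta - e, eta + e[%classic x -> Y y -> `|partial1of2 f x y| <= G y.
  by move=> xI _; rewrite df1; apply: norm_expR_bound => //; exact: near_e.
have dM := derivable_under_integral mY etaI intf derf G0 iG Gub.
have vM := differentiation_under_integral mY etaI intf derf G0 iG Gub.
apply: DeriveDef => //; rewrite -derive1E vM.
by apply: eq_Rintegral => y _; rewrite df1.
Qed.

(** The k-th moment of s under Q_eta; its derivative below is the covariance of s^k and s. *)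
Definition moment_ratio k eta := M k eta / M 0%N eta.
Local Notation rho := moment_ratio.

Lemma is_derive_moment_ratio k (eta : R) : N eta ->
  is_derive eta 1 (rho k) (rho k.+1 eta - rho k eta * rho 1%N eta).
Proof.
move=> Neta; have [_ M0 _] := natural_parametersP Neta.
have dk := is_derive_exp_moment k Neta; have d0 := is_derive_exp_moment 0 Neta.
have M0n : M 0%N eta != 0 by rewrite gt_eqF.
have dV := is_deriveV M0n d0.
rewrite (_ : rho k = M k * (fun x => (M 0%N x)^-1)); last by apply/funext.
apply: is_derive_eq; rewrite /rho /GRing.scale /= fctE.
by field.
Qed.

(** Mean, variance and third central moment of s under Q_eta, that is, the first three cumulants. As
    closed forms they are defined for all real eta; on N they are the derivatives of [kappa]. *)
Definition kappa1 eta := rho 1 eta.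
Definition kappa2 eta := rho 2 eta - rho 1 eta ^+ 2.
Definition kappa3 eta := rho 3 eta - 3 * rho 1 eta * rho 2 eta + 2 * rho 1 eta ^+ 3.

Let near_N (eta : R) : N eta -> \forall x \near eta, N x.
Proof. by move=> Neta; apply: open_nbhs_nbhs. Qed.

Lemma is_derive_kappa (eta : R) : N eta ->
  is_derive eta 1 (kappa lambda Y s) (kappa1 eta).
Proof.
move=> Neta; have [_ M0 _] := natural_parametersP Neta.
have d0 := is_derive_exp_moment 0 Neta.
apply: (@near_eq_is_derive _ _ _ (@ln R \o M 0%N)).
  near=> x; have Nx : N x by near: x; exact: near_N.
  by have [_ _ ->] := natural_parametersP Nx.
have dl := is_derive1_ln M0.
apply: is_derive_eq; rewrite /kappa1 /rho mulrC //.
Unshelve. all: by end_near. Qed.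

Lemma is_derive_kappa1 (eta : R) : N eta -> is_derive eta 1 kappa1 (kappa2 eta).
Proof. by move=> Neta; have := is_derive_moment_ratio 1 Neta; rewrite -expr2. Qed.

Lemma is_derive_kappa2 (eta : R) : N eta -> is_derive eta 1 kappa2 (kappa3 eta).
Proof.
move=> Neta.
have d1 := is_derive_moment_ratio 1 Neta; have d2 := is_derive_moment_ratio 2 Neta.
rewrite (_ : kappa2 = rho 2 - rho 1 ^+ 2); last by apply/funext.
apply: is_derive_eq; rewrite /kappa3 /GRing.scale /=.
by ring.
Qed.

Lemma continuous_kappa3 (eta : R) : N eta -> {for eta, continuous kappa3}.
Proof.
move=> Neta.
have c k : {for eta, continuous (rho k)}.
  apply: differentiable_continuous; apply/derivable1_diffP.
  by have ? := is_derive_moment_ratio k Neta; exact: ex_derive.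
rewrite (_ : kappa3 = (fun x => rho 3 x - 3 * (rho 1 x * rho 2 x) +
    2 * (rho 1 x * (rho 1 x * rho 1 x)))); last first.
  by apply/funext => x; rewrite /kappa3; ring.
apply: cvgD; first apply: cvgB; first exact: c.
- by apply: cvgM; [exact: cvg_cst|apply: cvgM; exact: c].
- by apply: cvgM; [exact: cvg_cst|apply: cvgM; [|apply: cvgM]; exact: c].
Qed.

(** Links the iterated derivative of the domination hypothesis to the closed form. Each derivative
    is known on N only; openness of N lets the next one be taken there. *)
Lemma derive1n3_kappa (eta : R) : N eta ->
  derive1n 3 (kappa lambda Y s) eta = kappa3 eta.
Proof.
move=> Neta.
have D1 x : N x -> derive1 (kappa lambda Y s) x = kappa1 x.
  by move=> Nx; rewrite derive1E; have ? := is_derive_kappa Nx; rewrite derive_val.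
have D2 x : N x -> derive1 (derive1 (kappa lambda Y s)) x = kappa2 x.
  move=> Nx; rewrite derive1E (@near_eq_derive _ _ _ _ kappa1); last first.
    by near=> z; apply: D1; near: z; exact: near_N.
  by have ? := is_derive_kappa1 Nx; rewrite derive_val.
rewrite derive1nS derive1E (@near_eq_derive _ _ _ _ kappa2); last first.
  by near=> z; rewrite derive1nS derive1n1; apply: D2; near: z; exact: near_N.
by have ? := is_derive_kappa2 Neta; rewrite derive_val.
Unshelve. all: by end_near. Qed.

Lemma ler_lnDx (A B x : R) : 0 < A -> 0 < B -> A * expR x <= B -> ln A + x <= ln B.
Proof. by move=> A0 B0 AB; rewrite -ler_expR expRD !lnK ?posrE. Qed.

(** Integrate exp(z) >= 1 + z at z = (b - a)(s - m) against exp(a s): as m is the mean of s under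
    Q_a, the linear term integrates to zero and M_0(b) >= exp(m (b - a)) M_0(a) remains. *)
Lemma kappa_tangent (a b : R) : N a -> N b ->
  kappa lambda Y s a + kappa1 a * (b - a) <= kappa lambda Y s b.
Proof.
move=> Na Nb; have [ia Ma ->] := natural_parametersP Na.
have [ib Mb ->] := natural_parametersP Nb.
set m := kappa1 a.
apply: ler_lnDx => //.
have i0 := exp_moment_integrable 0 Na; have i1 := exp_moment_integrable 1 Na.
have i0b := exp_moment_integrable 0 Nb.
pose c := expR (m * (b - a)).
pose f y := c * (1 - m * (b - a)) * (s y ^+ 0 * expR (a * s y)) +
  c * (b - a) * (s y ^+ 1 * expR (a * s y)).
have iA := integrableZl mY (c * (1 - m * (b - a))) i0.
have iB := integrableZl mY (c * (b - a)) i1.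
have fE : \int[lambda]_(y in Y) f y = M 0%N a * c.
  rewrite RintegralD// (RintegralZl _ mY i0) (RintegralZl _ mY i1).
  rewrite -/(M 0 a) -/(M 1 a).
  have -> : M 1 a = m * M 0%N a by rewrite /m /kappa1 /rho divfK ?gt_eqF.
  by ring.
rewrite -/c -fE; apply: le_Rintegral => //.
  exact: (integrableD mY iA iB).
move=> y Yy; rewrite /f !expr0 expr1 !mul1r.
have -> : expR (b * s y) = c * expR (a * s y) * expR ((b - a) * (s y - m)).
  by rewrite /c -!expRD; congr expR; ring.
have -> : c * (1 - m * (b - a)) * expR (a * s y) + c * (b - a) * (s y * expR (a * s y))
   = c * expR (a * s y) * (1 + (b - a) * (s y - m)) by ring.
by rewrite ler_wpM2l ?mulr_ge0 ?expR_ge0// expR_ge1Dx.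
Qed.

Hypothesis N0 : N !=set0.
Hypothesis idY : identifiable lambda Y s.

(** If the variance vanished, s would equal its mean m almost everywhere on Y, and then M_0(x) =
    exp(x m) lambda(Y) for every x in N. All densities would be the constant 1 / lambda(Y), against
    identifiability at eta and eta + e. *)
Lemma kappa2_gt0 (eta : R) : N eta -> 0 < kappa2 eta.
Proof.
move=> Neta; have [i_ M0 _] := natural_parametersP Neta.
set m := kappa1 eta.
have i0 := exp_moment_integrable 0 Neta; have i1 := exp_moment_integrable 1 Neta.
have i2 := exp_moment_integrable 2 Neta.
pose f y := (s y - m) ^+ 2 * expR (eta * s y).
have f0 y : 0 <= f y by rewrite mulr_ge0 ?sqr_ge0 ?expR_ge0.
have fE y : f y = s y ^+ 2 * expR (eta * s y) + (- (2 * m) * (s y ^+ 1 * expR (eta * s y))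
   + m ^+ 2 * (s y ^+ 0 * expR (eta * s y))) by rewrite /f; ring.
have i1' := integrableZl mY (- (2 * m)) i1.
have i0' := integrableZl mY (m ^+ 2) i0.
have ifY : lambda.-integrable Y (EFin \o f).
  apply: eq_integrable (integrableD mY i2 (integrableD mY i1' i0')) => // y _ /=.
  by rewrite fE.
have IE : kappa2 eta = (\int[lambda]_(y in Y) f y) / M 0%N eta.
  under eq_Rintegral do rewrite fE.
  rewrite RintegralD//; last exact: (integrableD mY i1' i0').
  rewrite RintegralD// (RintegralZl _ mY i0) (RintegralZl _ mY i1).
  rewrite -/(M 0 eta) -/(M 1 eta) -/(M 2 eta).
  by rewrite /m /kappa2 /kappa1 /rho; field; rewrite gt_eqF.
rewrite IE divr_gt0// lt_def Rintegral_ge0// andbT; apply/eqP => If0.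
have ae0 : ae_eq lambda Y (EFin \o f) (cst 0%E).
  apply/ae_eq_integral_abs => //; first by case/integrableP : ifY.
  under eq_integral do rewrite /= ger0_norm//.
  by rewrite -[LHS]fineK ?[X in X%:E]If0//; exact: integrable_fin_num.
have sm : {ae lambda, forall y, Y y -> s y = m}.
  apply: filterS ae0 => y h /h /= -[] /eqP; rewrite mulf_eq0 (gt_eqF (expR_gt0 _)) orbF.
  by rewrite sqrf_eq0 subr_eq0 => /eqP.
(* For an infinite lambda(Y), [fine] would return 0; positivity of [M 0 eta] = exp(eta m) L rules
   this out. *)
pose L := fine (lambda Y).
have M0E x : N x -> M 0%N x = expR (x * m) * L.
  move=> Nx; rewrite -Rintegral_cst// /Rintegral; congr fine.
  have [ix _ _] := natural_parametersP Nx.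
  apply: ae_eq_integral => //.
  - by case/integrableP : (exp_moment_integrable 0 Nx).
  - by apply: filterS sm => y h /h ->; rewrite expr0 mul1r.
have L0 : 0 < L.
  by move: M0; rewrite M0E// pmulr_rgt0// expR_gt0.
have dE x A : N x -> measurable A -> A `<=` Y ->
    model lambda Y s x A = (\int[lambda]_(y in A) (expR (- ln L))%:E)%E.
  move=> Nx mA AY; apply: ae_eq_integral => //.
  - apply/measurable_EFinP; apply: measurableT_comp => //.
    apply: measurable_funB => //; apply: measurable_funM => //.
    exact: measurable_funS ms.
  - apply: filterS sm => y h Ay; rewrite /density h; last exact: AY.
    have [_ _ ->] := natural_parametersP Nx.
    by rewrite M0E// lnM ?posrE ?expR_gt0// expRK; congr (expR _)%:E; ring.
have [e e0 eN] := nbhs_N Neta.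
have N1 : N (eta + e) by apply: eN; rewrite addrAC subrr add0r gtr0_norm.
have /eqP := idY Neta N1 (fun A mA AY => etrans (dE _ _ Neta mA AY) (esym (dE _ _ N1 mA AY))).
by rewrite -subr_eq0 opprD addrA subrr add0r oppr_eq0 gt_eqF.
Qed.

End ExpFamily.

(** * Row vectors: sup norm, pairing and rational points *)

Section RowVectors.
Context {R : realType} {D : nat}.
Implicit Types (t u v : 'rV[R]_D).

Lemma norm_coord_le v j : `|v 0 j| <= `|v|.
Proof.
by rewrite [leRHS]mx_normrE; apply: (le_bigmax _ (fun i => `|v i.1 i.2|) (0, j)).
Qed.

Lemma norm_rV_le v (c : R) : 0 <= c -> (forall j, `|v 0 j| <= c) -> `|v| <= c.
Proof.
by move=> c0 vc; rewrite [leLHS]mx_normrE; apply: bigmax_le => // -[i j] _; rewrite ord1.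
Qed.

Lemma norm_delta_le j : `|delta_mx 0 j : 'rV[R]_D| <= 1.
Proof.
by apply: norm_rV_le => // k; rewrite mxE; case: (_ && _); rewrite ?normr1 ?normr0.
Qed.

Lemma dotDl t u v : dot (t + u) v = dot t v + dot u v.
Proof. by rewrite /dot -big_split; apply: eq_bigr => j _; rewrite mxE mulrDl. Qed.

Lemma dotZl (a : R) u v : dot (a *: u) v = a * dot u v.
Proof. by rewrite /dot mulr_sumr; apply: eq_bigr => j _; rewrite mxE mulrA. Qed.

Lemma dotNl u v : dot (- u) v = - dot u v.
Proof. by rewrite -scaleN1r dotZl mulN1r. Qed.

Lemma dot_deltal j v : dot (delta_mx 0 j) v = v 0 j.
Proof.
rewrite /dot (bigD1 j)//= big1 ?addr0 ?mxE ?eqxx ?mul1r// => k kj.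
by rewrite mxE (negbTE kj) andbF mul0r.
Qed.

Lemma dotC u v : dot u v = dot v u.
Proof. by apply: eq_bigr => j _; rewrite mulrC. Qed.

(** The l1 norm, dual to the sup norm: [dot_le] is the matching Hölder inequality. Its cube expands
    into the products |x_j x_k x_l| of the domination hypothesis. *)
Definition sum_norm v : R := \sum_(j < D) `|v 0 j|.

Lemma sum_norm_ge0 v : 0 <= sum_norm v.
Proof. exact: sumr_ge0. Qed.

Lemma coord_le_sum_norm v j : `|v 0 j| <= sum_norm v.
Proof. by rewrite /sum_norm (bigD1 j)//= lerDl sumr_ge0. Qed.

Lemma dot_le u v : `|dot u v| <= `|u| * sum_norm v.
Proof.
rewrite (le_trans (ler_norm_sum _ _ _))// mulr_sumr ler_sum// => j _.
by rewrite normrM ler_wpM2r// norm_coord_le.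
Qed.

Lemma dot_continuous v : continuous (fun t => dot t v).
Proof.
move=> t; apply/(@cvgrPdist_le _ _ _ (nbhs t)) => e e0.
have c0 : 0 < sum_norm v + 1 by rewrite ltr_wpDl// sum_norm_ge0.
apply/nbhs_ballP; exists (e / (sum_norm v + 1)) => [|u]; first exact: divr_gt0.
rewrite mx_norm_ball /ball_ /= => tu.
rewrite -dotNl -dotDl (le_trans (dot_le _ _))//.
rewrite (@le_trans _ _ (`|t - u| * (sum_norm v + 1)))// ?ler_wpM2l ?lerDl//.
by rewrite -ler_pdivlMr// ltW.
Qed.

(** An enumeration of Q^D inside R^D; integers that encode no vector give 0. *)
Definition rational_point (n : nat) : 'rV[R]_D :=
  map_mx ratr (odflt 0 (unpickle n : option 'rV[rat]_D)).

Lemma rational_point_near t (e : R) : 0 < e ->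
  exists n, `|t - rational_point n| < e.
Proof.
move=> e0.
have : forall j : 'I_D, exists r : rat, `|t 0 j - ratr r| <= e / 2.
  move=> j; have [|r] := @rat_in_itvoo R (t 0 j - e / 2) (t 0 j + e / 2).
    by rewrite ltrD2l; lra.
  rewrite in_itv/= => /andP[h1 h2]; exists r; rewrite ler_distlC.
  by apply/andP; split; exact: ltW.
move=> /choice[r tr]; pose w : 'rV[rat]_D := \row_j r j.
exists (pickle w); rewrite /rational_point pickleK/=.
rewrite (@le_lt_trans _ _ (e / 2))//; last by lra.
by apply: norm_rV_le => [|j]; [rewrite ltW// divr_gt0|rewrite !mxE].
Qed.

End RowVectors.

(** * Convergence of convex functions from a dense set *)

Section ConvexLimits.
Context {R : realType} {D : nat}.
Implicit Types (t u v : 'rV[R]_D) (h : 'rV[R]_D -> R) (C : set 'rV[R]_D).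

Definition segment_closed C := forall t t' (a : R),
  C t -> C t' -> 0 <= a <= 1 -> C (a *: t + (1 - a) *: t').

Lemma segment_closed_mean C n (p : nat -> 'rV[R]_D) : segment_closed C ->
  (forall i, (i <= n)%N -> C (p i)) -> C (n.+1%:R^-1 *: \sum_(i < n.+1) p i).
Proof.
move=> sC; elim: n => [|n ih] Cp.
  by rewrite invr1 scale1r big_ord_recl big_ord0 addr0; exact: Cp.
have {}ih := ih (fun i hi => Cp i (leqW hi)).
have n2 : n.+2%:R != 0 :> R by rewrite pnatr_eq0.
have n1 : n.+1%:R != 0 :> R by rewrite pnatr_eq0.
have E : n.+2%:R = n.+1%:R + 1 :> R by rewrite -natr1.
have a01 : 0 <= (n.+1%:R / n.+2%:R : R) <= 1.
  by rewrite divr_ge0//= ler_pdivrMr ?ltr0n// mul1r ler_nat.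
rewrite big_ord_recr/= (_ : _ *: _ =
    (n.+1%:R / n.+2%:R) *: (n.+1%:R^-1 *: \sum_(i < n.+1) p i) +
    (1 - n.+1%:R / n.+2%:R) *: p n.+1); first exact: (sC _ _ _ ih (Cp n.+1 (leqnn _)) a01).
rewrite scalerA scalerDr; congr (_ *: _ + _ *: _); first by rewrite mulrAC divff// mul1r.
by rewrite -[X in X - _](divff n2) -mulrBl -natrB// subSnn mul1r.
Qed.

(** c + v is the mean over j of the points c + D v_j e_j, and each of these lies on the segment from
    c - rho e_j to c + rho e_j. So the 2D vertices of a cross-polytope, with its centre, control a
    cube of radius rho / D. *)
Lemma segment_closed_cube C c (rho : R) : segment_closed C -> 0 < rho -> C c ->
  (forall j, C (c + rho *: delta_mx 0 j) /\ C (c - rho *: delta_mx 0 j)) ->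
  forall v, (forall j, D%:R * `|v 0 j| <= rho) -> C (c + v).
Proof.
move=> sC rho0 Cc CE v vrho.
have Cj (j : 'I_D) : C (c + (D%:R * v 0 j) *: delta_mx 0 j).
  have [C1 C2] := CE j; pose a := (1 + D%:R * v 0 j / rho) / 2.
  have : `|D%:R * v 0 j / rho| <= 1.
    by rewrite normrM normfV (gtr0_norm rho0) ler_pdivrMr// mul1r normrM normr_nat.
  rewrite ler_norml => /andP[h1 h2].
  have a01 : 0 <= a <= 1 by rewrite /a; apply/andP; split; lra.
  have := sC _ _ a C1 C2 a01; congr C.
  apply/rowP => k; rewrite !mxE /a; field; rewrite gt_eqF//.
(* In dimension 0 there is no point to average over, but v is 0. *)
have [D0|D0] := posnP D.
  have v0 : v = 0 by apply/rowP => j; have := ltn_ord j; rewrite {2}D0.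
  by rewrite v0 addr0.
pose p (i : nat) := if insub i is Some j then c + (D%:R * v 0 j) *: delta_mx 0 j else c.
have pC i : C (p i) by rewrite /p; case: insubP.
have := segment_closed_mean sC (fun i (_ : (i <= D.-1)%N) => pC i).
rewrite prednK//; congr C.
rewrite (eq_bigr (fun j : 'I_D => c + (D%:R * v 0 j) *: delta_mx 0 j)); last first.
  by move=> j _; rewrite /p valK.
rewrite big_split/= sumr_const card_ord scalerDr -[c *+ D]scaler_nat scalerA.
have Dn : D%:R != 0 :> R by rewrite pnatr_eq0 -lt0n.
rewrite mulVf// scale1r; congr (_ + _).
rewrite [RHS]row_sum_delta scaler_sumr; apply: eq_bigr => j _.
by rewrite scalerA mulKf.
Qed.

(* [M] bounds [h] above on the whole cube, so reflecting through [c] bounds it below. *)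
Lemma convex_lipschitz Theta h c (delta M : R) :
  segment_closed Theta -> convex_on Theta h -> 0 < delta ->
  (forall v, `|v| < delta -> Theta (c + v) /\ h (c + v) <= M) -> - M <= h c ->
  forall u v, `|u| < delta / 2 -> `|v| < delta / 2 ->
    `|h (c + u) - h (c + v)| <= 8 * M / delta * `|u - v|.
Proof.
move=> sT ch d0 hM Mc.
have lb v : `|v| < delta -> - (3 * M) <= h (c + v).
  move=> vd; have [T1 h1] := hM _ vd.
  have [T2 h2] : Theta (c - v) /\ h (c - v) <= M by apply: hM; rewrite normrN.
  have a01 : 0 <= (2^-1 : R) <= 1 by apply/andP; split; lra.
  have E : 2^-1 *: (c + v) + (1 - 2^-1) *: (c - v) = c.
    by apply/rowP => j; rewrite !mxE; lra.
  have := ch _ _ _ T1 T2 a01 (sT _ _ _ T1 T2 a01); rewrite E.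
  move: Mc h2; lra.
have M0 : 0 <= M.
  have := hM 0; rewrite normr0 addr0 => /(_ d0)[_]; move: Mc; lra.
suff H u v : `|u| < delta / 2 -> `|v| < delta / 2 ->
    h (c + u) - h (c + v) <= 8 * M / delta * `|u - v|.
  move=> u v ud vd; rewrite ler_norml H// andbT lerNl opprB.
  by rewrite distrC; exact: H.
move=> ud vd; have [->|uv] := eqVneq u v; first by rewrite !subrr normr0 mulr0.
have uv0 : 0 < `|u - v| by rewrite normr_gt0 subr_eq0.
(* With this a, the point z = v + (u - v) / a is at distance delta / 2 from v, hence still in the
   cube, and u is a convex combination of z and v. *)
pose a := 2 * `|u - v| / delta.
have a0 : 0 < a by rewrite /a divr_gt0// mulr_gt0.
have -> : 8 * M / delta * `|u - v| = 4 * M * a by rewrite /a; field; rewrite gt_eqF.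
have d2 : delta / 2 < delta by lra.
have lu := (hM _ (lt_trans ud d2)).2; have [Tv _] := hM _ (lt_trans vd d2).
have lv := lb _ (lt_trans vd d2).
(* If a > 1, the oscillation M + 3M = 4M on the cube is already below 4 M a. *)
have [a1|a1] := leP a 1; last first.
  by rewrite (@le_trans _ _ (4 * M)) ?ler_peMr ?mulr_ge0 ?(ltW a1)//; lra.
pose z := v + a^-1 *: (u - v).
have zd : `|z| < delta.
  rewrite (le_lt_trans (ler_normD _ _))// normrZ normfV (gtr0_norm a0).
  have -> : a^-1 * `|u - v| = delta / 2 by rewrite /a; field; rewrite !gt_eqF.
  by move: vd; lra.
have [Tz hz] := hM _ zd.
have a01 : 0 <= a <= 1 by rewrite ltW.
have := ch _ _ _ Tz Tv a01 (sT _ _ _ Tz Tv a01).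
have -> : a *: (c + z) + (1 - a) *: (c + v) = c + u.
  by apply/rowP => j; rewrite !mxE; field; rewrite gt_eqF.
move=> h1; have : a * (h (c + z) - h (c + v)) <= a * (4 * M).
  by rewrite ler_pM2l//; move: hz lv; lra.
by move: h1; rewrite mulrBr; lra.
Qed.

(** The sublevel set at M is itself closed under segments, so bounds at finitely many points reach
    the whole cube. This turns pointwise convergence at those points into a common Lipschitz
    constant. Dividing by [D.+1] also covers dimension 0. *)
Lemma convex_lipschitz_vertices Theta h c (rho M : R) :
  segment_closed Theta -> convex_on Theta h -> 0 < rho -> Theta c ->
  (forall j, Theta (c + rho *: delta_mx 0 j) /\ Theta (c - rho *: delta_mx 0 j)) ->
  (forall j, h (c + rho *: delta_mx 0 j) <= M /\ h (c - rho *: delta_mx 0 j) <= M) ->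
  `|h c| <= M ->
  forall u v, `|u| < rho / D.+1%:R / 2 -> `|v| < rho / D.+1%:R / 2 ->
    `|h (c + u) - h (c + v)| <= 8 * M / (rho / D.+1%:R) * `|u - v|.
Proof.
move=> sT ch rho0 Tc Tv hv; rewrite ler_norml => /andP[hc1 hc2].
have D0 : 0 < D.+1%:R :> R by rewrite ltr0n.
pose C := [set y | Theta y /\ h y <= M].
have sC : segment_closed C.
  move=> y y' a [Ty hy] [Ty' hy'] /[dup] a01 /andP[a0 a1].
  split; first exact: sT.
  rewrite (le_trans (ch _ _ _ Ty Ty' a01 (sT _ _ _ Ty Ty' a01)))//.
  rewrite (@le_trans _ _ (a * M + (1 - a) * M))//; last by rewrite -mulrDl; lra.
  by rewrite lerD// ler_wpM2l// subr_ge0.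
apply: (convex_lipschitz sT ch) => //; first exact: divr_gt0.
move=> v vd; apply: (segment_closed_cube sC rho0) => //.
  by move=> j; split; split; [case: (Tv j)|case: (hv j)|case: (Tv j)|case: (hv j)].
move=> j; rewrite (@le_trans _ _ (D.+1%:R * `|v|))//.
  by rewrite ler_pM// ?ler_nat// norm_coord_le.
by rewrite mulrC -ler_pdivlMr// ltW.
Qed.

Lemma rational_point_map (w : 'rV[rat]_D) :
  exists k, rational_point k = map_mx ratr w :> 'rV[R]_D.
Proof. by exists (pickle w); rewrite /rational_point pickleK. Qed.

(** Near t, take a cross-polytope whose centre and vertices are all rational. Convergence there
    bounds [f n] eventually, so [f n] and [g] share a Lipschitz constant, and t is compared with a
    rational point p close to it. *)
Lemma convex_cvg_rational Theta (f : nat -> 'rV[R]_D -> R) (g : 'rV[R]_D -> R) :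
  open Theta -> segment_closed Theta ->
  (forall n, convex_on Theta (f n)) -> convex_on Theta g ->
  (forall k, Theta (rational_point k) ->
     f n (rational_point k) @[n --> \oo] --> g (rational_point k)) ->
  forall t, Theta t -> f n t @[n --> \oo] --> g t.
Proof.
move=> oT sT cf cg fg t Tt.
have /nbhs_ballP[e /= e0 eT] := open_nbhs_nbhs (conj oT Tt).
have {}eT v : `|v - t| < e -> Theta v.
  by move=> vt; apply: eT; rewrite mx_norm_ball /ball_ /= distrC.
(* The radius is rational so that the vertices belong to the enumeration. *)
have [|r] := @rat_in_itvoo R 0 (e / 2); first by rewrite divr_gt0.
rewrite in_itv/=; set rho : R := ratr r => /andP[rho0 rhoe].
pose delta := rho / D.+1%:R.
have delta0 : 0 < delta by rewrite divr_gt0// ltr0n.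
(* Within delta / 2 of c, the point t lies in the Lipschitz cube; within e / 2, the vertices around
   c stay at distance less than e from t, hence in [Theta]. *)
have b0 : 0 < Num.min (delta / 2) (e / 2) by rewrite lt_min; apply/andP; split; lra.
have [k] := rational_point_near t b0.
rewrite lt_min.
set c := rational_point k => /andP[td te].
have [w Ew] : exists w : 'rV[rat]_D, c = map_mx ratr w by eexists.
have vtx j (b : bool) : exists k, rational_point k = c + ((-1) ^+ b * rho) *: delta_mx 0 j.
  have [k' Ek'] := rational_point_map (w + ((-1) ^+ b * r) *: delta_mx 0 j).
  exists k'; rewrite Ek' Ew map_mxD map_mxZ map_delta_mx rmorphM rmorph_sign.
  by [].
have Tvtx j (b : bool) : Theta (c + ((-1) ^+ b * rho) *: delta_mx 0 j).
  apply: eT; rewrite addrAC (le_lt_trans (ler_normD _ _))//.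
  rewrite (splitr e) ltr_leD//; first by rewrite distrC.
  rewrite normrZ normrM normrX normrN normr1 expr1n mul1r gtr0_norm//.
  rewrite (@le_trans _ _ (rho * 1))//; last by rewrite mulr1 ltW.
  by rewrite ler_pM2l// norm_delta_le.
have Tc : Theta c by apply: eT; rewrite distrC (lt_trans te)//; lra.
pose gv (jb : 'I_D * bool) := g (c + ((-1) ^+ jb.2 * rho) *: delta_mx 0 jb.1).
(* The sum dominates every single value of [g], and the extra 1 absorbs the eventual error of
   [f n]. *)
pose M := \sum_jb `|gv jb| + `|g c| + 1.
have gvM jb : `|gv jb| + 1 <= M.
  by rewrite /M (bigD1 jb)//= -!addrA lerD2l addrA lerDr addr_ge0// sumr_ge0.
have gcM : `|g c| + 1 <= M by rewrite /M -addrA lerDr sumr_ge0.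
pose K := 8 * M / delta.
have lip h : convex_on Theta h -> `|h c| <= M ->
    (forall jb : 'I_D * bool, h (c + ((-1) ^+ jb.2 * rho) *: delta_mx 0 jb.1) <= M) ->
    forall u v, `|u - c| < delta / 2 -> `|v - c| < delta / 2 ->
      `|h u - h v| <= K * `|u - v|.
  move=> ch hc hv u v uc vc.
  have := @convex_lipschitz_vertices Theta h c rho M sT ch rho0 Tc _ _ hc (u - c) (v - c) uc vc.
  rewrite !subrKC opprB addrA subrK; apply => j.
    by have := (Tvtx j false, Tvtx j true); rewrite expr0 expr1 mul1r mulN1r scaleNr => -[].
  by have := (hv (j, false), hv (j, true)); rewrite /= expr0 expr1 mul1r mulN1r scaleNr => -[].
have lipg : forall u v, `|u - c| < delta / 2 -> `|v - c| < delta / 2 ->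
      `|g u - g v| <= K * `|u - v|.
  apply: lip => //; first by rewrite (le_trans _ gcM)// lerDl.
  by move=> jb; rewrite (le_trans (ler_norm _))// (le_trans _ (gvM jb))// lerDl.
have M0 : 0 < M by rewrite (lt_le_trans _ gcM)// ltr_wpDl.
have K0 : 0 < K by rewrite divr_gt0// mulr_gt0.
have lipf : \forall n \near \oo, forall u v, `|u - c| < delta / 2 -> `|v - c| < delta / 2 ->
      `|f n u - f n v| <= K * `|u - v|.
  have fc : \forall n \near \oo, `|g c - f n c| <= 1.
    move: (fg k Tc) => /cvgrPdist_le; exact.
  have fv : \forall n \near \oo, forall jb : 'I_D * bool,
      `|gv jb - f n (c + ((-1) ^+ jb.2 * rho) *: delta_mx 0 jb.1)| <= 1.
    apply: filter_forall => -[j b] /=; have [k' Ek'] := vtx j b.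
    move: (fg k'); rewrite Ek' => /(_ (Tvtx j b)) /cvgrPdist_le; exact.
  near=> n; apply: lip => //.
    have : `|g c - f n c| <= 1 by near: n.
    rewrite distrC => h1; rewrite (le_trans _ gcM)//.
    by rewrite -[f n c](subrK (g c)) addrC (le_trans (ler_normD _ _))// lerD2l.
  move=> jb; have : forall jb : 'I_D * bool,
      `|gv jb - f n (c + ((-1) ^+ jb.2 * rho) *: delta_mx 0 jb.1)| <= 1 by near: n.
  move=> /(_ jb); rewrite ler_distlC => /andP[_ h1].
  by rewrite (le_trans h1)// (le_trans _ (gvM jb))// lerD2r ler_norm.
apply/cvgrPdist_le => z z0.
(* The first entry keeps p in the Lipschitz cube around c; the second makes K |t - p| at most z /
   3. *)
pose eta := Num.min (delta / 2 - `|t - c|) (z / 3 / K).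
have eta0 : 0 < eta by rewrite lt_min subr_gt0 td/=; apply: divr_gt0 => //; exact: divr_gt0.
have [kp] := rational_point_near t eta0.
set p := rational_point kp; rewrite lt_min => /andP[pd pK].
have pc : `|p - c| < delta / 2.
  rewrite -(subrK t p) -addrA (le_lt_trans (ler_normD _ _))//.
  by rewrite [`|p - t|]distrC -ltrBrDr.
have Tp : Theta p.
  have dr : delta <= rho.
    by rewrite ler_pdivrMr ?ltr0n// ler_peMr ?ler1n//; exact: ltW.
  apply: eT; rewrite -(subrK c p) -addrA (le_lt_trans (ler_normD _ _))//.
  rewrite [`|c - t|]distrC (splitr e) ltrD// (lt_le_trans pc)//.
  rewrite (le_trans _ (ltW rhoe))// (le_trans _ dr)// ler_pdivrMr// ler_peMr ?ler1n//.
  exact: ltW.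
have fp : \forall n \near \oo, `|g p - f n p| <= z / 3.
  by move/cvgrPdist_le : (fg kp Tp); apply; rewrite divr_gt0.
near=> n.
have h1 := lipg _ _ td pc.
have h2 : `|f n p - f n t| <= K * `|p - t|.
  have : forall u v, `|u - c| < delta / 2 -> `|v - c| < delta / 2 ->
      `|f n u - f n v| <= K * `|u - v| by near: n.
  exact.
have h3 : `|g p - f n p| <= z / 3 by near: n.
have h4 : K * `|t - p| <= z / 3 by rewrite mulrC -ler_pdivlMr// ltW.
have -> : g t - f n t = (g t - g p) + (g p - f n p) + (f n p - f n t) by ring.
rewrite (le_trans (ler_normD _ _))// (le_trans (lerD (ler_normD _ _) (lexx _)))//.
have -> : z = z / 3 + z / 3 + z / 3 by field.
by rewrite lerD// ?lerD// ?(le_trans h1)// (le_trans h2)// distrC.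
Unshelve. all: by end_near. Qed.

End ConvexLimits.

(** * Taylor bounds in one variable *)

Section MeanValue.
Context {R : realType}.
Implicit Types (f df : R -> R).

Lemma mean_value_bound f df (B : R) :
  (forall tau : R, 0 <= tau <= 1 -> is_derive tau 1 f (df tau)) ->
  (forall tau : R, 0 <= tau <= 1 -> `|df tau| <= B) ->
  forall tau : R, 0 <= tau <= 1 -> `|f tau - f 0| <= B.
Proof.
move=> fdf dfB tau /andP[t0 t1].
have B0 : 0 <= B by rewrite (le_trans _ (dfB 0 _)) ?lexx ?ler01.
have [t0'|t0'] := ltP 0 tau; last first.
  have -> : tau = 0 by apply/le_anti; rewrite t0 t0'.
  by rewrite subrr normr0.
have ctau : {within `[0, tau], continuous f}.
  apply: derivable_within_continuous => x; rewrite in_itv/= => /andP[x0 xt].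
  have ? : is_derive x 1 f (df x) by apply: fdf; rewrite x0 (le_trans xt).
  exact: ex_derive.
have [|c] := @MVT R f df 0 tau t0' _ ctau.
  by move=> x; rewrite in_itv/= => /andP[/ltW x0 /ltW xt]; apply: fdf; rewrite x0 (le_trans xt).
rewrite in_itv/= => /andP[/ltW c0 /ltW ct] ->; rewrite subr0 normrM (ger0_norm t0).
rewrite (@le_trans _ _ (B * tau)) ?ler_wpM2r ?dfB ?c0 ?(le_trans ct)//.
by rewrite ler_piMr.
Qed.

End MeanValue.

Lemma is_derive_affine {R : realType} (a u tau : R) :
  is_derive tau 1 (fun x => a + x * u) u.
Proof.
rewrite (_ : (fun x => _) = cst a + u \*: id); last first.
  by apply/funext => x; rewrite !fctE mulrC.
by apply: is_derive_eq; rewrite add0r /GRing.scale /= mulr1.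
Qed.

Lemma is_derive_comp_affine {R : realType} (f : R -> R) (a u tau df : R) :
  is_derive (a + tau * u) 1 f df ->
  is_derive tau 1 (fun x => f (a + x * u)) (u * df).
Proof.
move=> h; have ha := is_derive_affine a u tau.
have := @is_derive1_comp R f (fun x => a + x * u) tau _ _ h ha.
by move=> h'; apply: is_derive_eq; rewrite /GRing.scale /= mulrC.
Qed.

Section Taylor.
Context {R : realType}.
Variables (N : set R) (k k1 k2 k3 : R -> R).
Hypothesis dk : forall x, N x -> is_derive x 1 k (k1 x).
Hypothesis dk1 : forall x, N x -> is_derive x 1 k1 (k2 x).
Hypothesis dk2 : forall x, N x -> is_derive x 1 k2 (k3 x).
Variables (a u : R).
Hypothesis Nau : forall tau : R, 0 <= tau <= 1 -> N (a + tau * u).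

Let comp_derive (f df : R -> R) (tau : R) : is_derive (a + tau * u) 1 f (df (a + tau * u)) ->
  is_derive tau 1 (fun x => f (a + x * u)) (u * df (a + tau * u)).
Proof. by move=> h; exact: is_derive_comp_affine. Qed.

Let at0 (f : R -> R) : f (a + 0 * u) = f a. Proof. by rewrite mul0r addr0. Qed.

(** The derivative in tau of a Taylor remainder is u times the remainder of one order less. Carrying
    a weight w inside the absolute value lets the three bounds chain, each calling the previous one
    with weight w u; the plain mean value bound gives up the factorials. *)
Lemma taylor_bound2 (w B : R) :
  (forall tau : R, 0 <= tau <= 1 -> `|w * u * k3 (a + tau * u)| <= B) ->
  forall tau : R, 0 <= tau <= 1 -> `|w * (k2 (a + tau * u) - k2 a)| <= B.
Proof.
move=> wB tau t01; pose f x := w * k2 (a + x * u).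
have -> : w * (k2 (a + tau * u) - k2 a) = f tau - f 0 by rewrite /f at0 mulrBr.
apply: (@mean_value_bound R f (fun x => w * u * k3 (a + x * u))) => // x x01.
have h := comp_derive (dk2 (Nau x01)).
rewrite (_ : f = w \*: (fun x => k2 (a + x * u))); last by apply/funext.
by rewrite -mulrA; exact: is_deriveZ.
Qed.

Lemma taylor_bound1 (w B : R) :
  (forall tau : R, 0 <= tau <= 1 -> `|w * u ^+ 2 * k3 (a + tau * u)| <= B) ->
  forall tau : R, 0 <= tau <= 1 ->
    `|w * (k1 (a + tau * u) - k1 a - k2 a * (tau * u))| <= B.
Proof.
(* The summand [0 + x * u] stays unsimplified so that its derivative is an instance of
   [is_derive_affine]. *)
move=> wB tau t01; pose f x := w * (k1 (a + x * u) - k2 a * (0 + x * u)).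
have -> : w * (k1 (a + tau * u) - k1 a - k2 a * (tau * u)) = f tau - f 0.
  by rewrite /f at0; ring.
apply: (@mean_value_bound R f (fun x => w * u * (k2 (a + x * u) - k2 a))) => // x x01; last first.
  by apply: taylor_bound2 => // y y01; rewrite -[w * u * u]mulrA -expr2; exact: wB.
have h := comp_derive (dk1 (Nau x01)); have ha := is_derive_affine 0 u x.
rewrite (_ : f = w \*: ((fun x => k1 (a + x * u)) - (k2 a \*: (fun x => 0 + x * u)))); last first.
  by apply/funext.
by apply: is_derive_eq; rewrite /GRing.scale /=; ring.
Qed.

Lemma taylor_bound0 (w B : R) :
  (forall tau : R, 0 <= tau <= 1 -> `|w * u ^+ 3 * k3 (a + tau * u)| <= B) ->
  forall tau : R, 0 <= tau <= 1 ->
    `|w * (k (a + tau * u) - k a - k1 a * (tau * u) - k2 a / 2 * (tau * u) ^+ 2)| <= B.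
Proof.
move=> wB tau t01.
pose f x := w * (k (a + x * u) - k1 a * (0 + x * u) -
  k2 a / 2 * ((0 + x * u) * (0 + x * u))).
have -> : w * (k (a + tau * u) - k a - k1 a * (tau * u) - k2 a / 2 * (tau * u) ^+ 2) =
    f tau - f 0 by rewrite /f at0; ring.
apply: (@mean_value_bound R f (fun x => w * u * (k1 (a + x * u) - k1 a - k2 a * (x * u))))
  => // x x01; last first.
  by apply: taylor_bound1 => // y y01; rewrite -[w * u * _]mulrA -exprS; exact: wB.
have h := comp_derive (dk (Nau x01)); have ha := is_derive_affine 0 u x.
rewrite (_ : f = w \*: ((fun x => k (a + x * u)) - (k1 a \*: (fun x => 0 + x * u)) -
   ((k2 a / 2) \*: ((fun x => 0 + x * u) * (fun x => 0 + x * u))))); last first.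
  by apply/funext.
by apply: is_derive_eq; rewrite /GRing.scale /=; field.
Qed.

End Taylor.

(** * Directional derivatives of functions of theta . x *)

Section Ridge.
Context {R : realType} {D : nat}.
Implicit Types (t v x : 'rV[R]_D).

(** The difference quotient in direction v is literally that of the one-variable function [G] at 0,
    so both derivability and value transfer. *)
Lemma is_derive_ridge (f : R -> R) (df : R) t v x : is_derive (dot t x) 1 f df ->
  is_derive t v (fun u => f (dot u x)) (dot v x * df).
Proof.
move=> h; pose G (y : R) := f (dot t x + y * dot v x).
have hG : is_derive (0 : R) 1 G (dot v x * df).
  by apply: is_derive_comp_affine; rewrite mul0r addr0.
have E : (fun y : R => y^-1 *: (((fun u => f (dot u x)) \o shift t) (y *: v) - f (dot t x))) =
    (fun y : R => y^-1 *: ((G \o shift 0) (y *: 1) - G 0)).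
  apply/funext => y /=; rewrite /G mul0r !addr0 dotDl dotZl [_ + dot t x]addrC.
  by rewrite (_ : y *: 1 = y)//; exact: mulr1.
case: hG => hG1 hG2; apply: DeriveDef.
  by move: hG1; rewrite /derivable -E.
by rewrite -hG2 /derive -E.
Qed.

Lemma is_derive_ridge_sum (I : finType) (x : I -> 'rV[R]_D) (f df : I -> R -> R) t v :
  (forall i, is_derive (dot t (x i)) 1 (f i) (df i (dot t (x i)))) ->
  is_derive t v (fun u => \sum_i f i (dot u (x i)))
    (\sum_i dot v (x i) * df i (dot t (x i))).
Proof.
move=> h; rewrite -(big_enum _ _ _ (fun i => dot v (x i) * df i (dot t (x i)))).
rewrite (_ : (fun u => _) = fun u => \sum_(i <- enum I) f i (dot u (x i))); last first.
  by apply/funext => u; rewrite big_enum.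
elim: (enum I) => [|i r ih].
  rewrite big_nil (_ : (fun u => _) = cst 0); first exact: is_derive_cst.
  by apply/funext => u; rewrite big_nil.
rewrite big_cons (_ : (fun u => _) = (fun u => f i (dot u (x i))) +
    (fun u => \sum_(i <- r) f i (dot u (x i)))); last first.
  by apply/funext => u; rewrite big_cons.
by apply: is_deriveD => //; exact: is_derive_ridge.
Qed.

End Ridge.

(** * Fréchet derivatives from quadratic remainders *)

Section Differentiability.
Context {R : realType} {V W : normedModType R}.

(** A remainder of order |v|^2 is o(v), and the explicit bound [B] makes the linear candidate
    continuous, so uniqueness of the differential identifies it. *)
Lemma differentiable_quadratic (F L : V -> W) t (C B : R) :
  linear L -> (forall v, `|L v| <= B * `|v|) ->
  (\forall v \near 0, `|F (v + t) - F t - L v| <= C * `|v| ^+ 2) ->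
  differentiable F t /\ 'd F t = L :> (V -> W).
Proof.
move=> linL LB FL.
pose lM := GRing.isLinear.Build _ _ _ _ _ linL.
pose L' : {linear V -> W} := HB.pack L lM.
have cL : continuous L'.
  apply: bounded_linear_continuous; apply/linear_boundedP.
  exists B; split; first exact: num_real.
  by move=> r Br v; rewrite (le_trans (LB v))// ler_wpM2r// ltW.
have FE : F \o shift t = cst (F t) + (L' : V -> W) +o_ 0 id.
  apply/eqaddoP => e e0.
  have c0 : 0 < `|C| + 1 by rewrite ltr_wpDl.
  have ec0 : 0 < e / (`|C| + 1) by exact: divr_gt0.
  near=> v.
  have -> : (F \o shift t - (cst (F t) + (L' : V -> W))) v = F (v + t) - F t - L v.
    by rewrite !fctE /= opprD addrA.
  have h1 : `|F (v + t) - F t - L v| <= C * `|v| ^+ 2 by near: v.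
  have h2 : `|v| < e / (`|C| + 1).
    by near: v; apply/nbhs_normP; exists (e / (`|C| + 1)) => // w; rewrite /ball_ /= sub0r normrN.
  rewrite (le_trans h1)// expr2 mulrA ler_wpM2r//.
  rewrite (@le_trans _ _ ((`|C| + 1) * `|v|))//.
    by rewrite ler_wpM2r// (le_trans (ler_norm _))// lerDl.
  by rewrite mulrC -ler_pdivlMr// ltW.
have dFE := diff_unique cL FE.
by split => //; apply/diff_locallyP; rewrite dFE.
Unshelve. all: by end_near. Qed.

End Differentiability.

(** * Derivatives and convexity of finite sums of losses *)

Section RidgeLoss.
Context {R : realType} {D : nat} {I : finType}.
Variables (N : set R) (k k1 k2 k3 : R -> R).
Hypothesis dk : forall x, N x -> is_derive x 1 k (k1 x).
Hypothesis dk1 : forall x, N x -> is_derive x 1 k1 (k2 x).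
Hypothesis dk2 : forall x, N x -> is_derive x 1 k2 (k3 x).
Hypothesis ck3 : forall x, N x -> {for x, continuous k3}.
Variables (Theta : set 'rV[R]_D) (x : I -> 'rV[R]_D) (sigma : I -> R) (c : R).
Hypothesis oTheta : open Theta.
Hypothesis NTheta : forall t i, Theta t -> N (dot t (x i)).

(** [sigma i] stands for s(Y_i). The index type is arbitrary so as to cover both the empirical loss,
    with c the inverse sample size, and the loss of one observation, with c = 1. *)
Definition ridge_loss (t : 'rV[R]_D) : R :=
  \sum_i c * (k (dot t (x i)) - dot t (x i) * sigma i).

Let nearTheta t : Theta t -> \forall u \near t, Theta u.
Proof. by move=> Tt; apply: open_nbhs_nbhs. Qed.

Let d1 (i : 'I_D) t : Theta t ->
  is_derive t (delta_mx 0 i : 'rV[R]_D) ridge_loss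
    (\sum_m x m 0 i * (c * (k1 (dot t (x m)) - sigma m))).
Proof.
move=> Tt; have := @is_derive_ridge_sum R D I x (fun m y => c * (k y - y * sigma m))
  (fun m y => c * (k1 y - sigma m)) t (delta_mx 0 i).
move=> H; refine (@is_derive_eq _ _ _ _ _ _ _ _ (H _) _); last first.
  by apply: eq_bigr => m _; rewrite dot_deltal.
move=> m; have h := dk (NTheta m Tt).
rewrite (_ : (fun y => _) = c \*: (k - (sigma m \*: id))); last first.
  by apply/funext => y; rewrite !fctE (mulrC y).
by apply: is_derive_eq; rewrite /GRing.scale /= mulr1.
Qed.

(** The preceding partial derivative has its closed form on [Theta] only; as [Theta] is open, this
    holds near t, which is all that the next derivative sees. *)
Let d2 (i j : 'I_D) t : Theta t ->
  is_derive t (delta_mx 0 i : 'rV[R]_D) (partial j ridge_loss)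
    (\sum_m x m 0 i * (x m 0 j * c * k2 (dot t (x m)))).
Proof.
move=> Tt.
apply: (@near_eq_is_derive _ _ _
    (fun u => \sum_m x m 0 j * (c * (k1 (dot u (x m)) - sigma m)))).
  near=> u; have Tu : Theta u by near: u; exact: nearTheta.
  by have ? := d1 j Tu; rewrite /partial derive_val.
have := @is_derive_ridge_sum R D I x (fun m y => x m 0 j * (c * (k1 y - sigma m)))
  (fun m y => x m 0 j * c * k2 y) t (delta_mx 0 i).
move=> H; refine (@is_derive_eq _ _ _ _ _ _ _ _ (H _) _); last first.
  by apply: eq_bigr => m _; rewrite dot_deltal.
move=> m; have h := dk1 (NTheta m Tt).
rewrite (_ : (fun y => _) = (x m 0 j * c) \*: (k1 - cst (sigma m))); last first.
  by apply/funext => y; rewrite !fctE mulrA.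
by apply: is_derive_eq; rewrite subr0.
Unshelve. all: by end_near. Qed.

Let d3 (i j l : 'I_D) t : Theta t ->
  is_derive t (delta_mx 0 i : 'rV[R]_D) (partial j (partial l ridge_loss))
    (\sum_m x m 0 i * (x m 0 j * (x m 0 l * c) * k3 (dot t (x m)))).
Proof.
move=> Tt.
apply: (@near_eq_is_derive _ _ _
    (fun u => \sum_m x m 0 j * (x m 0 l * c * k2 (dot u (x m))))).
  near=> u; have Tu : Theta u by near: u; exact: nearTheta.
  by have ? := d2 j l Tu; rewrite /partial derive_val.
have := @is_derive_ridge_sum R D I x (fun m y => x m 0 j * (x m 0 l * c * k2 y))
  (fun m y => x m 0 j * (x m 0 l * c) * k3 y) t (delta_mx 0 i).
move=> H; refine (@is_derive_eq _ _ _ _ _ _ _ _ (H _) _); last first.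
  by apply: eq_bigr => m _; rewrite dot_deltal.
move=> m; have h := dk2 (NTheta m Tt).
rewrite (_ : (fun y => _) = (x m 0 j * (x m 0 l * c)) \*: k2); last first.
  by apply/funext => y; rewrite /GRing.scale /= mulrA.
exact: is_deriveZ.
Unshelve. all: by end_near. Qed.

Lemma partial3_ridge_loss (i j l : 'I_D) t : Theta t ->
  partial3 i j l ridge_loss t =
  \sum_m c * (k3 (dot t (x m)) * x m 0 i * x m 0 j * x m 0 l).
Proof.
move=> Tt; have ? := d3 i j l Tt; rewrite /partial3 {1}/partial derive_val.
by apply: eq_bigr => m _; ring.
Qed.

Lemma continuous_third_derivatives_ridge_loss :
  continuous_third_derivatives Theta ridge_loss.
Proof.
move=> i j l t Tt; split.
- by have ? := d1 l Tt; exact: ex_derive.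
- by have ? := d2 j l Tt; exact: ex_derive.
- by have ? := d3 i j l Tt; exact: ex_derive.
- change (partial3 i j l ridge_loss u @[u --> t] --> partial3 i j l ridge_loss t).
  rewrite (partial3_ridge_loss _ _ _ Tt).
  apply: (@cvg_trans _ ((fun u => \sum_m c * (k3 (dot u (x m)) * x m 0 i * x m 0 j * x m 0 l)) @ t)).
    apply: (@near_eq_cvg _ _ (nbhs t)); near=> u; have Tu : Theta u by near: u; exact: nearTheta.
    by rewrite partial3_ridge_loss.
  have ck m : dot u (x m) @[u --> t] --> dot t (x m) by exact: dot_continuous.
  apply: (@cvg_big R I +%R 0 xpredT _ _ (nbhs t) _
    (fun m u => c * (k3 (dot u (x m)) * x m 0 i * x m 0 j * x m 0 l))) => [|m _].
    exact: (@add_continuous R).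
  apply: cvgM; first exact: cvg_cst.
  do 3! (apply: cvgM; last exact: cvg_cst).
  exact: (cvg_comp _ _ (ck m) (ck3 (NTheta m Tt))).
Unshelve. all: by end_near. Qed.

Lemma partial3_ridge_loss_le (i j l : 'I_D) t (B : I -> R) : Theta t -> 0 <= c ->
  (forall m, `|k3 (dot t (x m))| * sum_norm (x m) ^+ 3 <= B m) ->
  `|partial3 i j l ridge_loss t| <= c * \sum_m B m.
Proof.
move=> Tt c0 tB; rewrite partial3_ridge_loss// (le_trans (ler_norm_sum _ _ _))//.
rewrite mulr_sumr ler_sum// => m _; rewrite normrM (ger0_norm c0) ler_wpM2l//.
rewrite (le_trans _ (tB m))// !normrM -!mulrA ler_wpM2l// !exprS expr0 mulr1.
by rewrite ler_pM ?mulr_ge0 ?coord_le_sum_norm// ler_pM ?coord_le_sum_norm.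
Qed.

(** Apply the supporting line at the intermediate point z to both ends: in the combination with
    weights a and 1 - a the slopes cancel, and the term in [sigma] is linear. *)
Lemma convex_on_ridge_loss : 0 <= c ->
  (forall a b, N a -> N b -> k a + k1 a * (b - a) <= k b) ->
  convex_on Theta ridge_loss.
Proof.
move=> c0 tangent t t' a Tt Tt' /andP[a0 a1] Tm.
rewrite /ridge_loss !mulr_sumr -big_split/= ler_sum// => m _.
rewrite !(mulrCA _ c) -mulrDr ler_wpM2l// dotDl !dotZl.
have := tangent _ _ (NTheta m Tm) (NTheta m Tt).
have := tangent _ _ (NTheta m Tm) (NTheta m Tt').
rewrite dotDl !dotZl; set y := dot t (x m); set y' := dot t' (x m).
set z := a * y + (1 - a) * y'.
have b0 : 0 <= 1 - a by rewrite subr_ge0.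
move=> h1 h2.
have {}h1 := ler_wpM2l b0 h1; have {}h2 := ler_wpM2l a0 h2.
have -> : k z - z * sigma m = a * (k z + k1 z * (y - z)) + (1 - a) * (k z + k1 z * (y' - z))
   - z * sigma m by rewrite /z; ring.
have -> : a * (k y - y * sigma m) + (1 - a) * (k y' - y' * sigma m) =
  a * k y + (1 - a) * k y' - z * sigma m by rewrite /z; ring.
by rewrite lerD2r lerD.
Qed.

End RidgeLoss.

(** For nonnegative numbers the sum of squares is at most the square of the sum; this is applied
    once at each of the three nested sums. *)
Lemma norm_third_derivative_le {R : realType} {D : nat} (f : 'rV[R]_D -> R) t (B : R) :
  (forall i j l : 'I_D, `|partial3 i j l f t| <= B) ->
  norm_third_derivative f t <= \sum_(i < D) \sum_(j < D) \sum_(l < D) B.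
Proof.
move=> fB; have B0 (i : 'I_D) : 0 <= B by rewrite (le_trans _ (fB i i i)).
have S0 : 0 <= \sum_(i < D) \sum_(j < D) \sum_(l < D) B.
  by apply: sumr_ge0 => i _; apply: sumr_ge0 => j _; apply: sumr_ge0 => l _; exact: B0.
have sq (J : finType) (F G : J -> R) : (forall j, 0 <= G j) ->
    (forall j, F j <= G j ^+ 2) -> \sum_j F j <= (\sum_j G j) ^+ 2.
  move=> G0 FG; rewrite expr2 mulr_suml ler_sum// => j _.
  rewrite (le_trans (FG j))// expr2 ler_wpM2l// (bigD1 j)//= lerDl.
  by apply: sumr_ge0.
rewrite /norm_third_derivative -(ger0_norm S0) -sqrtr_sqr ler_sqrt ?sqr_ge0//.
apply: (sq _ _ (fun i => \sum_(j < D) \sum_(l < D) B)).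
  by move=> i; apply: sumr_ge0 => j _; apply: sumr_ge0 => l _; exact: B0.
move=> i; apply: (sq _ _ (fun j => \sum_(l < D) B)).
  by move=> j; apply: sumr_ge0 => l _; exact: B0.
move=> j; apply: (sq _ _ (fun l => B)); first by move=> l; exact: B0.
by move=> l; rewrite -(real_normK (num_real _)) ler_pXn2r ?nnegrE//; exact: B0.
Qed.

(** * Two differentiations of the expected loss under a third-order envelope *)

Section ExpectedLoss.
Context {R : realType} {D : nat} {d : measure_display} {Omega : measurableType d}
  (P : probability Omega R).
Variables (N : set R) (k k1 k2 k3 : R -> R).
Hypothesis oN : open N.
Hypothesis dk : forall x, N x -> is_derive x 1 k (k1 x).
Hypothesis dk1 : forall x, N x -> is_derive x 1 k1 (k2 x).
Hypothesis dk2 : forall x, N x -> is_derive x 1 k2 (k3 x).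
(** [W] is to be s(Y), and [Q] the integrable envelope of the third-order terms. *)
Variables (X : Omega -> 'rV[R]_D) (W Q : Omega -> R).
Variables (Theta E : set 'rV[R]_D).
Hypothesis oE : open E.
Hypothesis sE : segment_closed E.
Hypothesis ETheta : E `<=` Theta.
Hypothesis NX : forall t w, Theta t -> N (dot t (X w)).
Hypothesis mX : forall j, measurable_fun setT (fun w => X w 0 j).
Hypothesis iWX : forall j, P.-integrable setT (EFin \o (fun w => W w * X w 0 j)).
Hypothesis ik : forall t, Theta t -> P.-integrable setT (EFin \o (fun w => k (dot t (X w)))).
Hypothesis iQ : P.-integrable setT (EFin \o Q).
Hypothesis k3Q : forall t w, E t -> `|k3 (dot t (X w))| * sum_norm (X w) ^+ 3 <= Q w.

Local Notation int f := (P.-integrable setT (EFin \o f)).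

Let NE t w : E t -> N (dot t (X w)). Proof. by move/ETheta; exact: NX. Qed.

Let int_le (f g : Omega -> R) : measurable_fun setT f ->
  (forall w, `|f w| <= g w) -> int g -> int f.
Proof.
move=> mf fg; apply: le_integrable => //; first exact/measurable_EFinP.
by move=> w _ /=; rewrite lee_fin (le_trans (fg w))// ler_norm.
Qed.

Let int_add (f g : Omega -> R) : int f -> int g -> int (fun w => f w + g w).
Proof. by move=> fi gi; exact: (integrableD measurableT fi gi). Qed.

Let int_scale (a : R) (f : Omega -> R) : int f -> int (fun w => a * f w).
Proof. by move=> fi; exact: (integrableZl measurableT a fi). Qed.

Let int_sub (f g : Omega -> R) : int f -> int g -> int (fun w => f w - g w).
Proof. by move=> fi gi; exact: (integrableB measurableT fi gi). Qed.

Let int_norm (f : Omega -> R) : int f -> int (fun w => `|f w|).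
Proof. by move=> fi; exact: (integrable_norm fi). Qed.

Let int_sum (I : finType) (f : I -> Omega -> R) : (forall i, int (f i)) ->
  int (fun w => \sum_i f i w).
Proof. by move=> fi; exact: integrable_sumR. Qed.

Let mdot t : measurable_fun setT (fun w => dot t (X w)).
Proof. by apply: measurable_sum => j; apply: measurable_funM. Qed.

Let mcomp (f : R -> R) t : (forall x, N x -> {for x, continuous f}) -> E t ->
  measurable_fun setT (fun w => f (dot t (X w))).
Proof.
move=> cf Et; apply: (@measurable_comp _ _ _ _ _ _ N).
- exact: open_measurable.
- by move=> _ [w _ <-]; exact: NE.
- apply: open_continuous_measurable_fun => // x; rewrite inE; exact: cf.
- exact: mdot.
Qed.

Let der_cont (f df : R -> R) : (forall x, N x -> is_derive x 1 f (df x)) ->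
  forall x, N x -> {for x, continuous f}.
Proof.
move=> h x Nx; apply: differentiable_continuous; apply/derivable1_diffP.
by have ? := h x Nx; exact: ex_derive.
Qed.

Let mk2 t := mcomp (f := k2) (t := t) (der_cont dk2).
Let mk1 t := mcomp (f := k1) (t := t) (der_cont dk1).

Let nbE t : E t -> exists2 r : R, 0 < r & forall v, `|v| < r -> E (v + t).
Proof.
move=> Et; have /nbhs_ballP[r /= r0 rE] := open_nbhs_nbhs (conj oE Et).
exists r => // v vr; apply: rE; rewrite mx_norm_ball /ball_ /=.
by rewrite opprD addrCA subrr addr0 normrN.
Qed.

Section Expansions.
Variables (t v : 'rV[R]_D) (w : Omega).
Hypotheses (Et : E t) (Evt : E (v + t)).
Let x := X w.

Let seg (tau : R) : 0 <= tau <= 1 -> E (tau *: v + t).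
Proof.
move=> t01; have := sE Evt Et t01; congr E.
by rewrite scalerDr -addrA -scalerDl addrCA subrr addr0 scale1r.
Qed.

Let segN (tau : R) : 0 <= tau <= 1 -> N (dot t x + tau * dot v x).
Proof. by move=> /seg Es; have := NE w Es; rewrite dotDl dotZl addrC. Qed.

Let segQ (tau : R) : 0 <= tau <= 1 ->
  `|k3 (dot t x + tau * dot v x)| * sum_norm x ^+ 3 <= Q w.
Proof. by move=> /seg Es; have := k3Q w Es; rewrite dotDl dotZl addrC. Qed.

(** By convexity the segment from t to v + t stays in E, where [Q] dominates. In |v . x|^3 <= |v|^3
    times the cube of the l1 norm of x, that cube is exactly what [Q] absorbs. *)
Lemma loss_expansion0 :
  `|k (dot (v + t) x) - k (dot t x) - k1 (dot t x) * dot v x -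
    k2 (dot t x) / 2 * dot v x ^+ 2| <= `|v| ^+ 3 * Q w.
Proof.
have t1 : 0 <= (1 : R) <= 1 by rewrite ler01 lexx.
have := @taylor_bound0 R N k k1 k2 k3 dk dk1 dk2 (dot t x) (dot v x) segN 1
  (`|v| ^+ 3 * Q w) _ 1 t1.
rewrite !mul1r dotDl [dot v x + _]addrC; apply=> tau t01.
rewrite normrM normrX mulrC (le_trans _ (ler_wpM2l _ (segQ t01)))//.
rewrite [X in _ <= X]mulrCA ler_wpM2l// -exprMn.
by rewrite ler_pXn2r ?nnegrE ?mulr_ge0 ?sum_norm_ge0// dot_le.
Qed.

Lemma loss_expansion1 j :
  `|x 0 j * (k1 (dot (v + t) x) - k1 (dot t x) - k2 (dot t x) * dot v x)|
    <= `|v| ^+ 2 * Q w.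
Proof.
have t1 : 0 <= (1 : R) <= 1 by rewrite ler01 lexx.
have := @taylor_bound1 R N k1 k2 k3 dk1 dk2 (dot t x) (dot v x) segN (x 0 j)
  (`|v| ^+ 2 * Q w) _ 1 t1.
rewrite !mul1r dotDl [dot v x + _]addrC; apply=> tau t01.
rewrite normrM [X in X * _]normrM normrX mulrC (le_trans _ (ler_wpM2l _ (segQ t01)))//.
rewrite [X in _ <= X]mulrCA ler_wpM2l// (exprS _ 2) [X in _ <= X]mulrCA -exprMn ler_pM ?coord_le_sum_norm//.
by rewrite ler_pXn2r ?nnegrE ?mulr_ge0 ?sum_norm_ge0// dot_le.
Qed.

End Expansions.

(** Diagonal entries come from symmetric second differences along a coordinate; off-diagonal ones
    follow from 2 |x_i x_j| <= x_i^2 + x_j^2. *)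
Lemma integrable_k2XX t i j : E t ->
  int (fun w => k2 (dot t (X w)) * (X w 0 i * X w 0 j)).
Proof.
move=> Et.
have mXX a b : measurable_fun setT (fun w => k2 (dot t (X w)) * (X w 0 a * X w 0 b)).
  by apply: measurable_funM; [exact: mk2|exact: measurable_funM].
have diag a : int (fun w => `|k2 (dot t (X w))| * X w 0 a ^+ 2).
  have [r r0 rE] := nbE Et; pose h := r / 2.
  have h0 : 0 < h by rewrite divr_gt0.
  have nh : `|h *: delta_mx 0 a : 'rV[R]_D| <= h.
    by rewrite normrZ (gtr0_norm h0) ler_piMr ?norm_delta_le// ltW.
  have hr : h < r by rewrite /h; lra.
  have Ep : E (h *: delta_mx 0 a + t) by apply: rE; exact: le_lt_trans hr.
  have Em : E (- (h *: delta_mx 0 a) + t) by apply: rE; rewrite normrN; exact: le_lt_trans hr.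
  (* Each of the two shifted points contributes one remainder of size h^3 Q; dividing by h^2
     isolates the second derivative. *)
  pose G w := h ^- 2 * (`|k (dot (h *: delta_mx 0 a + t) (X w))| +
     `|k (dot (- (h *: delta_mx 0 a) + t) (X w))| + 2 * `|k (dot t (X w))| +
     2 * (h ^+ 3 * Q w)).
  have iG : int G.
    apply: int_scale; apply: int_add; last by do 2 apply: int_scale.
    apply: int_add; last by apply: int_scale; apply: int_norm; exact/ik/ETheta.
    by apply: int_add; apply: int_norm; exact/ik/ETheta.
  apply: int_le iG.
    apply: measurable_funM; last exact: measurable_funX.
    by apply: measurableT_comp => //; exact: mk2.
  move=> w; rewrite normrM normr_id normrX real_normK ?num_real//.
  rewrite ler_pdivlMl ?exprn_gt0//.
  have Q0 : 0 <= Q w.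
    by rewrite (le_trans _ (k3Q w Et))// mulr_ge0// exprn_ge0// sum_norm_ge0.
  have := loss_expansion0 w Et Ep; have := loss_expansion0 w Et Em.
  rewrite dotNl dotZl dot_deltal normrN sqrrN.
  have : `|h *: delta_mx 0 a : 'rV[R]_D| ^+ 3 * Q w <= h ^+ 3 * Q w.
    by rewrite ler_wpM2r// ler_pXn2r ?nnegrE// ltW.
  move: (_ ^+ 3 * Q w) (h ^+ 3 * Q w) => b1 b2 hb h1 h2.
  set kp := k (dot (h *: _ + t) _) in h2 *; set km := k (dot (- _ + t) _) in h1 *.
  set k0 := k _ in h1 h2 *; set u := h * X w 0 a in h1 h2.
  set c1 := k1 _ in h1 h2; set c2 := k2 _ in h1 h2 *.
  have -> : h ^+ 2 * (`|c2| * X w 0 a ^+ 2) = `|c2 * u ^+ 2|.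
    rewrite normrM [`|u ^+ 2|]ger0_norm ?sqr_ge0// /u; ring.
  (* The displacements u and -u cancel the first-order terms, whose integrability is not yet
     available. *)
  have -> : c2 * u ^+ 2 = kp + km - 2 * k0 -
      (kp - k0 - c1 * u - c2 / 2 * u ^+ 2) - (km - k0 - c1 * - u - c2 / 2 * u ^+ 2).
    by field.
  rewrite (le_trans (ler_normB _ _))//.
  rewrite (le_trans (lerD (ler_normB _ _) (lexx _)))//.
  have h4 : `|kp + km - 2 * k0| <= `|kp| + `|km| + 2 * `|k0|.
    rewrite (le_trans (ler_normB _ _))// normrM ger0_norm// lerD2r.
    exact: ler_normD.
  rewrite -addrA lerD// mulr_natl mulr2n lerD//; exact: le_trans hb.
have i1 := int_scale (2^-1) (int_add (diag i) (diag j)).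
apply: int_le i1 => // w; rewrite !normrM -mulrDr [X in _ <= X]mulrCA ler_wpM2l//.
rewrite -(real_normK (num_real (X w 0 i))) -(real_normK (num_real (X w 0 j))).
by have := sqr_ge0 (`|X w 0 i| - `|X w 0 j|); rewrite sqrrB; lra.
Qed.

(** A one-sided difference leaves a second-order term, which [integrable_k2XX] has just made
    integrable; this fixes the order of the two lemmas. *)
Lemma integrable_k1X t j : E t -> int (fun w => X w 0 j * k1 (dot t (X w))).
Proof.
move=> Et.
have [r r0 rE] := nbE Et; pose h := r / 2.
have h0 : 0 < h by rewrite divr_gt0.
have nh : `|h *: delta_mx 0 j : 'rV[R]_D| <= h.
  by rewrite normrZ (gtr0_norm h0) ler_piMr ?norm_delta_le// ltW.
have hr : h < r by rewrite /h; lra.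
have Ep : E (h *: delta_mx 0 j + t) by apply: rE; exact: le_lt_trans hr.
pose G w := h^-1 * (`|k (dot (h *: delta_mx 0 j + t) (X w))| + `|k (dot t (X w))| +
   h ^+ 2 / 2 * `|k2 (dot t (X w)) * (X w 0 j * X w 0 j)| + h ^+ 3 * Q w).
have iG : int G.
  apply: int_scale; apply: int_add; last exact: int_scale.
  apply: int_add; last by apply: int_scale; apply: int_norm; exact: integrable_k2XX.
  by apply: int_add; apply: int_norm; exact/ik/ETheta.
apply: int_le iG; first by apply: measurable_funM => //; exact: mk1.
move=> w; rewrite ler_pdivlMl// -[X in X * `|_|](gtr0_norm h0) -normrM.
have Q0 : 0 <= Q w.
  by rewrite (le_trans _ (k3Q w Et))// mulr_ge0// exprn_ge0// sum_norm_ge0.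
have := loss_expansion0 w Et Ep.
rewrite dotZl dot_deltal.
have : `|h *: delta_mx 0 j : 'rV[R]_D| ^+ 3 * Q w <= h ^+ 3 * Q w.
  by rewrite ler_wpM2r// ler_pXn2r ?nnegrE// ltW.
move: (_ ^+ 3 * Q w) (h ^+ 3 * Q w) => b1 b2 hb h2.
set kp := k (dot (h *: _ + t) _) in h2 *.
set k0 := k _ in h2 *; set u := h * X w 0 j in h2.
set c1 := k1 _ in h2 *; set c2 := k2 _ in h2 *.
have -> : h * (X w 0 j * c1) = kp - k0 - c2 / 2 * u ^+ 2 -
    (kp - k0 - c1 * u - c2 / 2 * u ^+ 2) by rewrite /u; field.
have -> : h ^+ 2 / 2 * `|c2 * (X w 0 j * X w 0 j)| = `|c2 / 2 * u ^+ 2|.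
  rewrite -[h ^+ 2 / 2]ger0_norm ?divr_ge0 ?sqr_ge0// -normrM; congr `|_|.
  by rewrite /u; field.
rewrite (le_trans (ler_normB _ _))// lerD//; last exact: le_trans hb.
by rewrite (le_trans (ler_normB _ _))// lerD2r ler_normB.
Qed.

Lemma integrable_dotW v : int (fun w => dot v (X w) * W w).
Proof.
rewrite (_ : (fun w => _) = fun w => \sum_j v 0 j * (W w * X w 0 j)).
  by apply: int_sum => j; exact/int_scale/iWX.
by apply/funext => w; rewrite mulr_suml; apply: eq_bigr => j _; ring.
Qed.

Definition expected_ridge_loss t := \int[P]_w (k (dot t (X w)) - dot t (X w) * W w).
Local Notation g := expected_ridge_loss.

Let int_loss t : Theta t -> int (fun w => k (dot t (X w)) - dot t (X w) * W w).
Proof. by move=> Tt; apply: int_sub; [exact: ik|exact: integrable_dotW]. Qed.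

Definition loss_grad t : 'rV[R]_D :=
  \row_j \int[P]_w (X w 0 j * k1 (dot t (X w)) - W w * X w 0 j).

Definition loss_hess t : 'M[R]_D :=
  \matrix_(i, j) \int[P]_w (k2 (dot t (X w)) * (X w 0 i * X w 0 j)).

Let Rint_norm_le (f G : Omega -> R) : int f -> int G -> (forall w, `|f w| <= G w) ->
  `|\int[P]_w f w| <= \int[P]_w G w.
Proof.
move=> fi Gi fG; rewrite (le_trans (le_normr_Rintegral measurableT fi))//.
by apply: le_Rintegral => //; exact: int_norm.
Qed.

Let int_grad t j : E t -> int (fun w => X w 0 j * k1 (dot t (X w)) - W w * X w 0 j).
Proof. by move=> Et; apply: int_sub => //; exact: integrable_k1X. Qed.

Lemma dot_loss_grad t v : E t ->
  int (fun w => dot v (X w) * k1 (dot t (X w)) - dot v (X w) * W w) /\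
  dot v (loss_grad t) =
  \int[P]_w (dot v (X w) * k1 (dot t (X w)) - dot v (X w) * W w).
Proof.
move=> Et.
have E1 : (fun w => dot v (X w) * k1 (dot t (X w)) - dot v (X w) * W w) =
    fun w => \sum_j v 0 j * (X w 0 j * k1 (dot t (X w)) - W w * X w 0 j).
  apply/funext => w; rewrite -mulrBr mulr_suml; apply: eq_bigr => j _.
  by ring.
have iv j : int (fun w => v 0 j * (X w 0 j * k1 (dot t (X w)) - W w * X w 0 j)).
  exact/int_scale/int_grad.
rewrite E1; split; first exact: int_sum.
rewrite Rintegral_sum//; apply: eq_bigr => j _.
by rewrite mxE RintegralZl//; exact: int_grad.
Qed.

Let int_k2S t : E t -> int (fun w => `|k2 (dot t (X w))| * sum_norm (X w) ^+ 2).
Proof.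
move=> Et.
rewrite (_ : (fun w => _) = fun w => \sum_i \sum_j
    `|k2 (dot t (X w)) * (X w 0 i * X w 0 j)|).
  by apply: int_sum => i; apply: int_sum => j; apply: int_norm; exact: integrable_k2XX.
apply/funext => w; rewrite expr2 mulr_suml mulr_sumr; apply: eq_bigr => i _.
rewrite mulr_sumr mulr_sumr; apply: eq_bigr => j _.
by rewrite !normrM.
Qed.

Lemma differentiable_expected_loss t : E t ->
  differentiable g t /\ forall v, 'd g t v = dot v (loss_grad t).
Proof.
move=> Et; have [r r0 rE] := nbE Et.
(* The second-order Taylor term contributes |k2| / 2 times the squared l1 norm. The third-order term
   is |v|^3 Q, at most |v|^2 Q in the unit ball, whence the radius [Num.min r 1] below. *)
pose C := \int[P]_w (2^-1 * (`|k2 (dot t (X w))| * sum_norm (X w) ^+ 2) + Q w).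
have iC : int (fun w => 2^-1 * (`|k2 (dot t (X w))| * sum_norm (X w) ^+ 2) + Q w).
  by apply: int_add => //; exact/int_scale/int_k2S.
have [] := @differentiable_quadratic R _ _ g (fun v => dot v (loss_grad t)) t C
  (sum_norm (loss_grad t)).
- by move=> a u v; rewrite dotDl dotZl.
- by move=> v; rewrite mulrC dot_le.
- apply/nbhs_normP; exists (Num.min r 1); first by rewrite /= lt_min r0 ltr01.
  move=> v; rewrite /ball_ /= sub0r normrN lt_min => /andP[vr v1].
  have Evt := rE _ vr.
  have [ig ->] := dot_loss_grad v Et.
  have i1 := int_loss (ETheta Evt); have i2 := int_loss (ETheta Et).
  rewrite /g -RintegralB// -RintegralB//; last exact: int_sub.
  rewrite [leRHS]mulrC -RintegralZl//.
  apply: Rint_norm_le; [exact: (int_sub (int_sub i1 i2) ig)|exact: int_scale|].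
  move=> w; have := loss_expansion0 w Et Evt.
  have Q0 : 0 <= Q w.
    by rewrite (le_trans _ (k3Q w Et))// mulr_ge0// exprn_ge0// sum_norm_ge0.
  have h3 : `|v| ^+ 3 * Q w <= `|v| ^+ 2 * Q w.
    by rewrite ler_wpM2r// exprSr ler_piMr// ltW.
  have h2 : `|k2 (dot t (X w)) / 2 * dot v (X w) ^+ 2| <=
      `|v| ^+ 2 * (2^-1 * (`|k2 (dot t (X w))| * sum_norm (X w) ^+ 2)).
    rewrite normrM normrX [X in X * _]normrM [`|2^-1|]ger0_norm//.
    have -> : `|v| ^+ 2 * (2^-1 * (`|k2 (dot t (X w))| * sum_norm (X w) ^+ 2)) =
       `|k2 (dot t (X w))| / 2 * (`|v| * sum_norm (X w)) ^+ 2 by ring.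
    by rewrite ler_wpM2l ?mulr_ge0// ler_pXn2r ?nnegrE ?mulr_ge0 ?sum_norm_ge0// dot_le.
  move=> h0; rewrite mulrDr.
  have -> : k (dot (v + t) (X w)) - dot (v + t) (X w) * W w -
     (k (dot t (X w)) - dot t (X w) * W w) -
     (dot v (X w) * k1 (dot t (X w)) - dot v (X w) * W w) =
     k2 (dot t (X w)) / 2 * dot v (X w) ^+ 2 + (k (dot (v + t) (X w)) - k (dot t (X w)) -
      k1 (dot t (X w)) * dot v (X w) - k2 (dot t (X w)) / 2 * dot v (X w) ^+ 2).
    by rewrite [in X in X * W w]dotDl; ring.
  by rewrite (le_trans (ler_normD _ _))// lerD// (le_trans h0).
- by move=> dg dgE; split => // v; rewrite dgE.
Qed.

Lemma grad_expected_loss t : E t -> grad g t = loss_grad t.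
Proof.
move=> Et; have [dg dgE] := differentiable_expected_loss Et.
by apply/rowP => j; rewrite mxE /partial deriveE// dgE dot_deltal.
Qed.

Lemma differentiable_grad_expected_loss t : E t ->
  differentiable (grad g) t /\ forall v, 'd (grad g) t v = v *m loss_hess t.
Proof.
move=> Et; have [r r0 rE] := nbE Et.
(* The expansion of x_j k1 has a remainder of at most |v|^2 Q, so the mean of [Q] is the constant;
   the sup norm lets each coordinate be estimated separately. *)
have [] := @differentiable_quadratic R _ _ (grad g) (fun v => v *m loss_hess t) t
  (\int[P]_w Q w) (\sum_i \sum_j `|loss_hess t i j|).
- by move=> a u v; rewrite mulmxDl scalemxAl.
- move=> v; apply: norm_rV_le => [|j].
    by rewrite mulr_ge0//; apply: sumr_ge0 => i _; apply: sumr_ge0.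
  rewrite mxE (le_trans (ler_norm_sum _ _ _))// mulr_suml ler_sum// => i _.
  rewrite normrM mulrC ler_pM ?norm_coord_le//.
  by rewrite (bigD1 j)//= lerDl sumr_ge0.
- apply/nbhs_normP; exists r => // v; rewrite /ball_ /= sub0r normrN => vr.
  have Evt := rE _ vr.
  rewrite !grad_expected_loss//.
  have IQ0 : 0 <= \int[P]_w Q w.
    apply: Rintegral_ge0 => w _.
    by rewrite (le_trans _ (k3Q w Et))// mulr_ge0// exprn_ge0// sum_norm_ge0.
  apply: norm_rV_le => [|j]; first by rewrite mulr_ge0// sqr_ge0.
  have iv i : int (fun w => v 0 i * (k2 (dot t (X w)) * (X w 0 i * X w 0 j))).
    exact/int_scale/integrable_k2XX.
  rewrite [X in `|X|](_ : _ = loss_grad (v + t) 0 j - loss_grad t 0 j -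
      (v *m loss_hess t) 0 j); last by rewrite !mxE.
  have -> : (v *m loss_hess t) 0 j =
      \int[P]_w (\sum_i v 0 i * (k2 (dot t (X w)) * (X w 0 i * X w 0 j))).
    rewrite mxE Rintegral_sum//; apply: eq_bigr => i _.
    by rewrite mxE RintegralZl//; exact: integrable_k2XX.
  have i1 := int_grad j Evt; have i2 := int_grad j Et; have i3 := int_sum iv.
  rewrite !mxE -RintegralB// -RintegralB//; last exact: int_sub.
  rewrite mulrC -RintegralZl//.
  apply: Rint_norm_le; [exact: (int_sub (int_sub i1 i2) i3)|exact: int_scale|].
  move=> w; have := loss_expansion1 w Et Evt j; congr (`|_| <= _).
  have -> : \sum_i v 0 i * (k2 (dot t (X w)) * (X w 0 i * X w 0 j)) =
      X w 0 j * k2 (dot t (X w)) * dot v (X w).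
    by rewrite mulr_sumr; apply: eq_bigr => i _; ring.
  by ring.
- by move=> dg dgE; split => // v; rewrite dgE.
Qed.

Lemma hessian_expected_loss t : E t -> hessian g t = loss_hess t.
Proof.
move=> Et; have [_ dE] := differentiable_grad_expected_loss Et.
apply/matrixP => i j; rewrite /hessian /jacobian mxE dE.
by rewrite -rowE mxE.
Qed.

Hypothesis k2_gt0 : forall x, N x -> 0 < k2 x.
Hypothesis tangent : forall a b, N a -> N b -> k a + k1 a * (b - a) <= k b.
Hypothesis nondegX : forall v : 'rV[R]_D, {ae P, forall w, dot v (X w) = 0} -> v = 0.

Lemma posdef_hessian_expected_loss t : E t -> posdef (hessian g t).
Proof.
move=> Et; rewrite hessian_expected_loss//; split.
  by apply/matrixP => i j; rewrite !mxE; apply: eq_Rintegral => w _; rewrite (mulrC (X w 0 i)).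
move=> v v0.
have iij i j : int (fun w => v 0 i * v 0 j * (k2 (dot t (X w)) * (X w 0 i * X w 0 j))).
  exact/int_scale/integrable_k2XX.
have fE : (fun w => k2 (dot t (X w)) * dot v (X w) ^+ 2) = fun w =>
    \sum_j \sum_i v 0 i * v 0 j * (k2 (dot t (X w)) * (X w 0 i * X w 0 j)).
  apply/funext => w; rewrite expr2 {2}/dot !mulr_sumr; apply: eq_bigr => j _.
  rewrite mulr_suml mulr_sumr; apply: eq_bigr => i _; ring.
have if_ : int (fun w => k2 (dot t (X w)) * dot v (X w) ^+ 2).
  by rewrite fE; apply: int_sum => j; exact: int_sum.
have -> : dot (v *m loss_hess t) v = \int[P]_w (k2 (dot t (X w)) * dot v (X w) ^+ 2).
  rewrite fE Rintegral_sum//; last by move=> j; exact: int_sum.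
  apply: eq_bigr => j _; rewrite Rintegral_sum// mxE mulr_suml; apply: eq_bigr => i _.
  rewrite RintegralZl//; last exact: integrable_k2XX.
  by rewrite mxE; ring.
have f0 w : 0 <= k2 (dot t (X w)) * dot v (X w) ^+ 2.
  by rewrite mulr_ge0 ?sqr_ge0// ltW// k2_gt0//; exact: NE.
rewrite lt_def Rintegral_ge0// andbT; apply: contra v0 => /eqP I0; apply/eqP.
apply: nondegX.
have : ae_eq P setT (EFin \o (fun w => k2 (dot t (X w)) * dot v (X w) ^+ 2)) (cst 0%E).
  apply/ae_eq_integral_abs => //; first by case/integrableP : if_.
  under eq_integral do rewrite /= ger0_norm//.
  by rewrite -[LHS]fineK ?[X in X%:E]I0//; exact: integrable_fin_num.
apply: filterS => w /(_ I) /= -[] /eqP; rewrite mulf_eq0 gt_eqF ?k2_gt0//=; last exact: NE.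
by rewrite sqrf_eq0 => /eqP.
Qed.

Lemma hessian_exists_expected_loss t : E t -> hessian_exists g t.
Proof.
move=> Et; split; last by have [] := differentiable_grad_expected_loss Et.
have : nbhs t E by apply: open_nbhs_nbhs.
by apply: filterS => u /differentiable_expected_loss[].
Qed.

Lemma convex_on_expected_loss : convex_on Theta g.
Proof.
move=> t t' a Tt Tt' /[dup] a01 /andP[a0 a1] Tm.
have i1 := int_loss Tt; have i2 := int_loss Tt'; have i3 := int_loss Tm.
rewrite /g -RintegralZl// -RintegralZl// -RintegralD//; [|exact: int_scale..].
apply: le_Rintegral => //; first by apply: int_add; exact: int_scale.
move=> w _.
(* For a fixed outcome the integrand is a ridge loss with a single summand. *)
have := @convex_on_ridge_loss R D unit N k k1 Theta (fun=> X w) (fun=> W w) 1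
  (fun t _ => NX w) ler01 tangent t t' a Tt Tt' a01 Tm.
by rewrite /ridge_loss !big_const card_unit /= !addr0 !mul1r.
Qed.

End ExpectedLoss.

(** * Euclidean balls in the sup-norm topology *)

Section EuclideanBalls.
Context {R : realType} {D : nat}.
Implicit Types (t u v c : 'rV[R]_D) (E : set 'rV[R]_D).

Lemma continuous_coord j : continuous (fun u => u 0 j).
Proof.
rewrite (_ : (fun u => _) = fun u => dot u (delta_mx 0 j)); first exact: dot_continuous.
by apply/funext => u; rewrite dotC dot_deltal.
Qed.

(** A polynomial description of the ball: openness, convexity and boundedness then need no square
    root. *)
Let sqdist c t : R := \sum_(j < D) (t 0 j - c 0 j) ^+ 2.

Lemma eballE c (r : R) : 0 < r ->
  [set t | enorm (t - c) < r] = [set t | sqdist c t < r ^+ 2].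
Proof.
move=> r0; apply/seteqP; split => t /=.
  rewrite /enorm -{1}(gtr0_norm r0) -sqrtr_sqr ltr_sqrt ?exprn_gt0// => h.
  by rewrite (le_lt_trans _ h)// ler_sum// => j _; rewrite !mxE.
move=> h; rewrite /enorm -[ltRHS](gtr0_norm r0) -sqrtr_sqr ltr_sqrt ?exprn_gt0//.
by rewrite (le_lt_trans _ h)// ler_sum// => j _; rewrite !mxE.
Qed.

Lemma open_eball E : is_open_eball E -> open E.
Proof.
move=> [c [r [r0 ->]]]; rewrite eballE//.
have cs : continuous (sqdist c).
  move=> t; apply: (@cvg_big R _ +%R 0 xpredT _ _ (nbhs t) _
    (fun j u => (u 0 j - c 0 j) ^+ 2)) => [|j _]; first exact: (@add_continuous R).
  pose f u := u 0 j - c 0 j.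
  have h : f @ t --> f t.
    apply: (@cvgB R R _ (nbhs t) (nbhs_filter t)); first exact: continuous_coord.
    exact: cvg_cst.
  rewrite (_ : (fun x => _) = f \* f); last by apply/funext => x; rewrite expr2.
  by rewrite expr2; apply: cvgM.
by apply: (@open_comp _ _ (sqdist c) [set x : R | x < r ^+ 2]) => [t _|]; [exact: cs|exact: open_lt].
Qed.

Lemma segment_closed_eball E : is_open_eball E -> segment_closed E.
Proof.
move=> [c [r [r0 ->]]]; rewrite eballE// => t t' a /= ht ht' /andP[a0 a1].
have b0 : 0 <= 1 - a by rewrite subr_ge0.
apply: (@le_lt_trans _ _ (a * sqdist c t + (1 - a) * sqdist c t')).
  rewrite !mulr_sumr -big_split ler_sum// => j _ /=; rewrite !mxE -subr_ge0.
  (* The convexity defect of the square is a (1 - a) (x - y)^2. *)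
  rewrite [leRHS](_ : _ = (a * (1 - a)) * (t 0 j - t' 0 j) ^+ 2); last by ring.
  by rewrite mulr_ge0 ?sqr_ge0// mulr_ge0.
(* Strictness is drawn from the first summand and needs a > 0. *)
have [->|an0] := eqVneq a 0; first by rewrite mul0r add0r subr0 mul1r.
have {an0}a0 : 0 < a by rewrite lt_def an0.
rewrite (_ : r ^+ 2 = a * r ^+ 2 + (1 - a) * r ^+ 2); last by ring.
by rewrite ltr_leD ?ltr_pM2l// ler_wpM2l// ltW.
Qed.

Lemma eball_bounded E : is_open_eball E -> exists2 M : R, 0 < M & forall t, E t -> `|t| <= M.
Proof.
move=> [c [r [r0 ->]]]; rewrite eballE//; exists (r + `|c|) => [|t /= ht].
  by rewrite ltr_wpDr.
rewrite -[t](subrK c) (le_trans (ler_normD _ _))// lerD2r.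
apply: norm_rV_le => [|j]; first exact: ltW.
rewrite !mxE -(@ler_pXn2r _ 2)// ?nnegrE ?(ltW r0)// -normrX ger0_norm ?sqr_ge0//.
rewrite (le_trans _ (ltW ht))// /sqdist (bigD1 j)//= lerDl.
by apply: sumr_ge0 => i _; exact: sqr_ge0.
Qed.

Lemma bounded_set_eball E : is_open_eball E -> bounded_set E.
Proof.
move=> /eball_bounded[M M0 EM]; exists M; split; first exact: num_real.
by move=> x Mx t /EM h; exact: le_trans h (ltW Mx).
Qed.

Lemma compact_closure_eball E : is_open_eball E -> compact (closure E).
Proof.
move=> /eball_bounded[M M0 EM]; apply: bounded_closed_compact; last exact: closed_closure.
exists (M + 1); split; first exact: num_real.
move=> x Mx t clt; have [|u [Eu]] := clt (ball t 1); first exact: nbhsx_ballx.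
rewrite mx_norm_ball /ball_ /= => tu.
rewrite -[t](subrK u) (le_trans (ler_normD _ _))// (le_trans _ (ltW Mx))//.
by rewrite addrC lerD ?EM// ltW.
Qed.

End EuclideanBalls.

(** * Borel measurability of coordinates and pairings *)

Section BorelRV.
Context {R : realType} {D : nat}.

Lemma measurable_coord (j : 'I_D) :
  measurable_fun setT (fun x : borelRV R D => (x : 'rV[R]_D) 0 j).
Proof.
apply: (measurability _ (RGenOInfty.measurableE R)) => //.
move=> _ [_ [r ->] <-]; rewrite setTI; apply: sub_sigma_algebra.
apply: (@open_comp _ _ (fun x : 'rV[R]_D => x 0 j)) => [t _|]; last exact: interval_open.
exact: continuous_coord.
Qed.

Lemma measurable_dot (t : 'rV[R]_D) :
  measurable_fun setT (fun x : borelRV R D => dot t x).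
Proof.
by apply: measurable_sum => j; apply: measurable_funM => //; exact: measurable_coord.
Qed.

Lemma measurable_sum_norm : measurable_fun setT (fun x : borelRV R D => sum_norm x).
Proof.
by apply: measurable_sum => j; apply: measurableT_comp => //; exact: measurable_coord.
Qed.

End BorelRV.

(** * A measurable envelope over the closed ball *)

Section Envelope.
Context {R : realType} {D : nat}.
Variables (N : set R) (h : R -> R).
Hypothesis oN : open N.
Hypothesis ch : forall x, N x -> {for x, continuous h}.
Variables (E : set 'rV[R]_D) (Xset : set 'rV[R]_D).
Hypothesis eE : is_open_eball E.
Hypothesis E0 : E !=set0.
Hypothesis NE : forall t x, closure E t -> Xset x -> N (dot t x).

Local Notation q := (@rational_point R D).

(** [h] is patched by zero outside N so that the term is measurable in every x, not only on [Xset].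
    Indices whose rational point is outside E contribute 0, harmless among nonnegative terms. *)
Definition envelope_term (n : nat) (x : 'rV[R]_D) : R :=
  if pselect (E (q n)) then `|(h \_ N) (dot (q n) x)| else 0.

Definition ereal_envelope (x : 'rV[R]_D) : \bar R :=
  ereal_sup (range (fun n => (envelope_term n x)%:E)).

Definition envelope (x : 'rV[R]_D) : R := fine (ereal_envelope x).

Lemma measurable_fun_patch_open (f : R -> R) :
  (forall x, N x -> {for x, continuous f}) -> measurable_fun setT (f \_ N).
Proof.
move=> cf; apply/(measurable_restrictT _ _).1; first exact: open_measurable.
by apply: open_continuous_measurable_fun => // x; rewrite inE; exact: cf.
Qed.

Lemma measurable_envelope : measurable_fun setT (fun x : borelRV R D => envelope x).
Proof.
have mt n : measurable_fun setT (fun x : borelRV R D => (envelope_term n x)%:E).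
  apply/measurable_EFinP; rewrite /envelope_term; case: pselect => [Eq|nEq]; last exact: measurable_cst.
  apply: measurableT_comp => //; apply: measurableT_comp; last exact: measurable_dot.
  exact: measurable_fun_patch_open.
have me : measurable_fun setT (fun x : borelRV R D => ereal_envelope x).
  rewrite (_ : (fun x => _) =
      fun x => esups (fun n => (envelope_term n x)%:E) 0%N); first exact: measurable_fun_esups.
  apply/funext => x.
  by rewrite /esups /ereal_envelope /=; congr ereal_sup; apply/seteqP; split => y [n _ <-]; exists n.
exact: (measurableT_comp (fine_measurable measurableT) me).
Qed.

Lemma envelope_term_ge0 n x : 0 <= envelope_term n x.
Proof. by rewrite /envelope_term; case: pselect. Qed.

Section Point.
Variable x : 'rV[R]_D.
Hypothesis Xx : Xset x.

Let cont t : closure E t -> (fun u => `|h (dot u x)|) @ t --> `|h (dot t x)|.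
Proof.
move=> Et; have c1 : {for t, continuous ((fun y => `|h y|) \o (fun u => dot u x))}.
  apply: continuous_comp; first exact: dot_continuous.
  by apply: cvg_norm; exact: (ch (NE Et Xx)).
exact: c1.
Qed.

(** For x in [Xset] the function |h(t . x)| is continuous on the compact closure of E, hence bounded
    there, so [fine] loses nothing. *)
Lemma envelope_fin : ereal_envelope x = (envelope x)%:E.
Proof.
have cw : {within closure E, continuous (fun u => `|h (dot u x)|)}.
  by apply: continuous_in_subspaceT => t; rewrite inE; exact: cont.
have /compact_bounded[M [_ HM]] := continuous_compact cw (compact_closure_eball eE).
have {}HM t : closure E t -> `|h (dot t x)| <= M + 1.
  move=> Et; have M1 : M < M + 1 by rewrite ltrDl.
  by have := HM _ M1 _ (ex_intro2 _ _ t Et erefl); rewrite /= normr_id.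
rewrite /envelope fineK// fin_numElt; apply/andP; split.
  apply: (@lt_le_trans _ _ (envelope_term 0 x)%:E); first exact: ltNyr.
  by apply: ereal_sup_ubound; exists 0%N.
apply: (@le_lt_trans _ _ (Num.max (M + 1) 0)%:E); last exact: ltry.
apply: ge_ereal_sup => _ [n _ <-]; rewrite lee_fin /envelope_term le_max.
case: pselect => [Eq|nE] /=; last by rewrite lexx orbT.
have clq : closure E (q n) by exact: subset_closure.
by rewrite patchE mem_set ?HM//; exact: NE.
Qed.

Lemma envelope_ge0 : 0 <= envelope x.
Proof.
rewrite -lee_fin -envelope_fin (@le_trans _ _ (envelope_term 0 x)%:E)//.
  by rewrite lee_fin envelope_term_ge0.
by apply: ereal_sup_ubound; exists 0%N.
Qed.

(** A value above the envelope at t would persist near t. There lies a point u of E, and near u a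
    rational point of the open set E, where the envelope is an upper bound by construction. *)
Lemma envelope_ub t : closure E t -> `|h (dot t x)| <= envelope x.
Proof.
move=> Et; rewrite leNgt; apply/negP => lt_h.
have : \forall u \near t, envelope x < `|h (dot u x)|.
  by have := cont Et => /cvgr_gt; apply.
move=> /nbhs_ballP[e /= e0 eh].
have e2 : 0 < e / 2 by rewrite divr_gt0.
have [u [Eu tu]] := Et _ (nbhsx_ballx t (e / 2) e2).
have /nbhs_ballP[r /= r0 rE] := open_nbhs_nbhs (conj (open_eball eE) Eu).
have m0 : 0 < Num.min r (e / 2) by rewrite lt_min r0 divr_gt0.
have [n] := rational_point_near u m0; rewrite lt_min => /andP[ur ue].
have Eq : E (q n) by apply: rE; rewrite mx_norm_ball.
have : envelope x < `|h (dot (q n) x)|.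
  apply: eh; rewrite mx_norm_ball /ball_ /=; move: tu; rewrite mx_norm_ball /ball_ /= => tu.
  by rewrite -[t](subrK u) -addrA (le_lt_trans (ler_normD _ _))// (splitr e) ltrD.
apply/negP; rewrite -leNgt -lee_fin -envelope_fin.
apply: ereal_sup_ubound; exists n => //; rewrite /envelope_term.
case: pselect => // Eq2 /=; rewrite patchE mem_set//.
by apply: NE => //; exact: subset_closure.
Qed.

(** Turns the integrand of the domination hypothesis, a supremum over uncountably many theta, into a
    measurable function. An equality allows rewriting under the integral; [h'] is the iterated
    derivative, known to agree with [h] on N only. *)
Lemma ereal_sup_envelope (h' : R -> R) (a b c : R) : (forall y, N y -> h' y = h y) ->
  ereal_sup [set (`|h' (dot t x) * a * b * c|)%:E | t in closure E] =
  (envelope x * `|a * b * c|)%:E.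
Proof.
move=> h'E; set S := ereal_sup _; set p := `|a * b * c|.
have elt t : closure E t -> `|h' (dot t x) * a * b * c| = `|h (dot t x)| * p.
  by move=> Et; rewrite h'E; [rewrite -!mulrA normrM /p !mulrA|exact: NE].
have S_le : (S <= (envelope x * p)%:E)%E.
  apply: ge_ereal_sup => _ [t Et <-]; rewrite lee_fin elt//.
  by apply: ler_wpM2r; [exact: normr_ge0|exact: envelope_ub].
have S_ge t : closure E t -> ((`|h (dot t x)| * p)%:E <= S)%E.
  by move=> Et; apply: ereal_sup_ubound; exists t => //; rewrite elt.
have [u Eu] := E0; have clu : closure E u by exact: subset_closure.
have S0 : (0 <= S)%E by rewrite (le_trans _ (S_ge _ clu))// lee_fin mulr_ge0 ?normr_ge0.
apply/eqP; rewrite eq_le S_le /=.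
move: S0 S_ge S_le; case: S => [s| |] //; rewrite ?leey// !lee_fin => s0 S_ge _.
have [p0|p0] := eqVneq p 0; first by rewrite p0 mulr0.
have {}p0 : 0 < p by rewrite lt_def p0 normr_ge0.
rewrite -ler_pdivlMr// -lee_fin -envelope_fin; apply: ge_ereal_sup => _ [n _ <-].
rewrite lee_fin /envelope_term; case: pselect => [Eq|nE] /=; last exact: divr_ge0 s0 (ltW p0).
have clq : closure E (q n) by exact: subset_closure.
rewrite patchE mem_set; last exact: NE.
by rewrite ler_pdivlMr// -lee_fin S_ge.
Qed.

End Point.

End Envelope.

(** * Assembly for the generalised linear model *)

Lemma segment_closed_convex_set {R : realType} {D : nat} (C : set 'rV[R]_D) :
  convex_set (C : set (convex_lmodType 'rV[R]_D)) -> segment_closed C.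
Proof.
move=> cC t t' a Ct Ct' /andP[a0 a1].
by have := cC t t' (Itv01 a0 a1) (mem_set Ct) (mem_set Ct'); rewrite inE.
Qed.

Theorem theorem13 (R : realType) (D d : nat)
  (lambda : {measure set (borelRV R d) -> \bar R})
  (Yset : set (borelRV R d)) (s : borelRV R d -> R)
  (hfam : exponential_family lambda Yset s)
  (Xset : set (borelRV R D)) (mXset : measurable Xset)
  (Theta : set 'rV[R]_D) (oTheta : open Theta)
  (cTheta : convex_set (Theta : set (convex_lmodType 'rV[R]_D)))
  (hnat : forall (theta x : 'rV[R]_D), Theta theta -> Xset x ->
     natural_parameters lambda Yset s (dot theta x))
  (disp : measure_display) (Omega : measurableType disp)
  (P : probability Omega R)
  (X : nat -> Omega -> borelRV R D) (Y : nat -> Omega -> borelRV R d)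
  (hval : forall i w, Xset (X i w) /\ Yset (Y i w))
  (hiid : iid P (fun i w => (X i w, Y i w)))
  (theta0 : 'rV[R]_D) (htheta0 : Theta theta0)
  (h1 : grad_vanishes (expected_loss lambda Yset s P X Y) theta0)
  (h2 : ('E_P[fun w => (enorm (s (Y 0%N w) *: (X 0%N w : 'rV[R]_D)))%R] < +oo)%E /\
     forall theta, Theta theta ->
       ('E_P[fun w => `|kappa lambda Yset s (dot theta (X 0%N w))|%R] < +oo)%E)
  (h3 : forall a : 'rV[R]_D,
     {ae P, forall w, dot a (X 0%N w) = 0} -> a = 0)
  (h4 : exists E : set 'rV[R]_D,
     dominated_third_derivative lambda Yset s P X Theta theta0 E) :
  forall E : set 'rV[R]_D,
    dominated_third_derivative lambda Yset s P X Theta theta0 E ->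
    {ae P, forall w, CN Theta theta0 E
      (fun n theta => empirical_loss lambda Yset s X Y n w theta)}.
Proof.
move=> E [eE E0 clE hH].
have [mY _ ms [oN _] idY] := hfam.
set N := natural_parameters lambda Yset s in hnat oN.
set k := kappa lambda Yset s in h2.
pose k1 := kappa1 lambda Yset s; pose k2 := kappa2 lambda Yset s.
pose k3 := kappa3 lambda Yset s.
have dk : forall x, N x -> is_derive x 1 k (k1 x) := is_derive_kappa mY ms oN.
have dk1 : forall x, N x -> is_derive x 1 k1 (k2 x) := is_derive_kappa1 mY ms oN.
have dk2 : forall x, N x -> is_derive x 1 k2 (k3 x) := is_derive_kappa2 mY ms oN.
have ck3 : forall x, N x -> {for x, continuous k3} := continuous_kappa3 mY ms oN.
have ck x : N x -> {for x, continuous k}.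
  move=> Nx; apply: differentiable_continuous; apply/derivable1_diffP.
  by have ? := dk _ Nx; exact: ex_derive.
have tangent : forall a b, N a -> N b -> k a + k1 a * (b - a) <= k b := kappa_tangent mY ms oN.
have k2_gt0 : forall x, N x -> 0 < k2 x := kappa2_gt0 mY ms oN idY.
have sT := segment_closed_convex_set cTheta.
have oE := open_eball eE; have sE := segment_closed_eball eE.
have ETheta : E `<=` Theta by apply: subset_trans clE; exact: subset_closure.
have NX i t w : Theta t -> N (dot t (X i w)) by move=> Tt; apply: hnat => //; case: (hval i w).
have [mZ _ _] := hiid.
have mX i : measurable_fun setT (X i) := measurableT_comp measurable_fst (mZ i).
have mYi i : measurable_fun setT (Y i) := measurableT_comp measurable_snd (mZ i).
have mXj i j : measurable_fun setT (fun w => (X i w : 'rV[R]_D) 0 j).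
  exact: (measurableT_comp (measurable_coord j) (mX i)).
(* [s] is measurable on [Yset] only, and [kappa] is regular on N only. The extensions by zero [sY]
   and [kN] are measurable everywhere, as the strong law demands, and agree with the originals at
   the observations. *)
pose sY : borelRV R d -> R := s \_ Yset.
have msY : measurable_fun setT sY by exact/(measurable_restrictT _ _).1.
have sYE i w : sY (Y i w) = s (Y i w).
  by rewrite /sY patchE mem_set//; case: (hval i w).
pose kN : R -> R := k \_ N.
have mkN : measurable_fun setT kN by exact: measurable_fun_patch_open.
have kNE i t w : Theta t -> kN (dot t (X i w)) = k (dot t (X i w)).
  by move=> Tt; rewrite /kN patchE mem_set//; exact: NX.
pose W w := s (Y 0%N w).
have mW : measurable_fun setT W.
  rewrite (_ : W = sY \o Y 0%N); first exact: (measurableT_comp msY (mYi 0%N)).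
  by apply/funext => w /=; rewrite sYE.
have mdotX i t : measurable_fun setT (fun w => dot t (X i w)).
  exact: (measurableT_comp (measurable_dot t) (mX i)).
have iWX j : P.-integrable setT (EFin \o (fun w => W w * (X 0%N w : 'rV[R]_D) 0 j)).
  apply/integrableP; split; first by apply/measurable_EFinP; exact: measurable_funM.
  have [+ _] := h2; rewrite unlock; apply: le_lt_trans; apply: ge0_le_integral => //.
  - by apply: measurableT_comp => //; apply/measurable_EFinP; exact: measurable_funM.
  - apply/measurable_EFinP; rewrite /enorm.
    apply: (measurableT_comp (continuous_measurable_fun (@sqrt_continuous R))).
    apply: measurable_sum => l; rewrite /=.
    rewrite (_ : (fun w => _) = fun w => (W w * (X 0%N w : 'rV[R]_D) 0 l) *
      (W w * (X 0%N w : 'rV[R]_D) 0 l)); last by apply/funext => w; rewrite !mxE.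
    by apply: measurable_funM; exact: measurable_funM.
  - move=> w _ /=; rewrite lee_fin /enorm -sqrtr_sqr ler_sqrt; last first.
      by apply: sumr_ge0 => l _; exact: sqr_ge0.
    by rewrite /dot (bigD1 j)//= !mxE -expr2 lerDl sumr_ge0// => l _; exact: sqr_ge0.
have ik t : Theta t -> P.-integrable setT (EFin \o (fun w => k (dot t (X 0%N w)))).
  move=> Tt; apply/integrableP; split.
    apply/measurable_EFinP; rewrite (_ : (fun w => _) = kN \o (fun w => dot t (X 0%N w))).
      exact: (measurableT_comp mkN).
    by apply/funext => w /=; rewrite kNE.
  by have [_ /(_ _ Tt)] := h2; rewrite unlock.
pose env := envelope N k3 E.
have NcE (t x : 'rV[R]_D) : closure E t -> Xset x -> N (dot t x).
  by move=> /clE; exact: hnat.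
have En0 : E !=set0 by exists theta0.
have menv : measurable_fun setT (fun x : borelRV R D => env x) := measurable_envelope oN ck3 E.
pose qf (x : borelRV R D) : R := env x * sum_norm x ^+ 3.
have mqf : measurable_fun setT qf.
  by apply: measurable_funM => //; apply: measurable_funX; exact: measurable_sum_norm.
have env0 i w : 0 <= env (X i w).
  by apply: (envelope_ge0 ck3 eE NcE); case: (hval i w).
have iQ : P.-integrable setT (EFin \o (fun w => qf (X 0%N w))).
  (* The cube of the l1 norm expands into one summand per triple of indices, and the domination
     hypothesis bounds each of them. *)
  rewrite (_ : (fun w => qf _) = fun w => \sum_i \sum_j \sum_l
    (env (X 0%N w) * `|(X 0%N w : 'rV[R]_D) 0 i * (X 0%N w : 'rV[R]_D) 0 j *
       (X 0%N w : 'rV[R]_D) 0 l|)).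
    apply: integrable_sumR => // i; apply: integrable_sumR => // j.
    apply: integrable_sumR => // l; apply/integrableP; split.
      apply/measurable_EFinP; apply: measurable_funM.
        exact: (measurableT_comp menv (mX 0%N)).
      by apply: measurableT_comp => //; do 2 (apply: measurable_funM => //).
    have := hH i j l; congr (_ < _)%E; apply: eq_integral => w _.
    rewrite (ereal_sup_envelope ck3 eE En0 NcE (proj1 (hval 0%N w)) _ _ _
      (derive1n3_kappa mY ms oN)).
    by rewrite /= (ger0_norm (mulr_ge0 (env0 0%N w) (normr_ge0 _))).
  apply/funext => w; rewrite /qf; set x := X 0%N w; set e := env x.
  have -> : sum_norm x ^+ 3 = sum_norm x * (sum_norm x * sum_norm x) by ring.
  rewrite {1}/sum_norm mulr_suml mulr_sumr; apply: eq_bigr => i _.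
  rewrite {1}/sum_norm mulr_suml !mulr_sumr; apply: eq_bigr => j _.
  rewrite /sum_norm !mulr_sumr; apply: eq_bigr => l _.
  by rewrite !normrM; ring.
pose g := expected_ridge_loss P k (X 0%N) W.
have k3Q i t w : E t -> `|k3 (dot t (X i w))| * sum_norm (X i w) ^+ 3 <= qf (X i w).
  move=> Et; rewrite /qf ler_wpM2r ?exprn_ge0 ?sum_norm_ge0//.
  apply: (envelope_ub ck3 eE NcE); first by case: (hval i w).
  exact: subset_closure.
have hess := hessian_exists_expected_loss oN dk dk1 dk2 oE sE ETheta (NX 0%N) (mXj 0%N) iWX ik iQ (k3Q 0%N) E0.
have pd := posdef_hessian_expected_loss oN dk dk1 dk2 oE sE ETheta (NX 0%N) (mXj 0%N) iWX ik iQ (k3Q 0%N) k2_gt0 h3 E0.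
have [dg _] := differentiable_expected_loss oN dk dk1 dk2 oE sE ETheta (NX 0%N) (mXj 0%N) iWX ik iQ (k3Q 0%N) E0.
have cg : convex_on Theta g := convex_on_expected_loss (NX 0%N) iWX ik tangent.
have idotW := integrable_dotW iWX.
have iloss t : Theta t ->
    P.-integrable setT (EFin \o (fun w => k (dot t (X 0%N w)) - dot t (X 0%N w) * W w)).
  by move=> Tt; exact: (integrableB measurableT (ik t Tt) (idotW t)).
have gE t : Theta t -> expected_loss lambda Yset s P X Y t = g t.
  move=> Tt; rewrite /expected_loss unlock -mulN1r /g /expected_ridge_loss.
  rewrite (_ : fine _ = \int[P]_w (dot t (X 0%N w) * W w - k (dot t (X 0%N w)))).
    rewrite -RintegralZl//; last exact: (integrableB measurableT (idotW t) (ik t Tt)).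
    by apply: eq_Rintegral => w _; ring.
  by apply: eq_Rintegral => w _; rewrite /density expRK.
have empE n w : empirical_loss lambda Yset s X Y n w =
    ridge_loss k (fun i : 'I_n.+1 => X i w : 'rV[R]_D) (fun i => s (Y i w)) n.+1%:R^-1.
  apply/funext => t; rewrite /empirical_loss /ridge_loss -mulr_sumr -mulrN -sumrN.
  by congr (_ * _); apply: eq_bigr => i _; rewrite /density expRK opprB.
(* Differentiability of [g] comes from [dg]; the value of its gradient comes from [h1], since both
   losses agree on the open set [Theta]. *)
have gv : grad_vanishes g theta0.
  split => //; have [_ <-] := h1; apply/rowP => j; rewrite !mxE; apply: near_eq_derive.
  have : nbhs theta0 Theta by apply: open_nbhs_nbhs.
  by apply: filterS => t /gE ->.
pose phi t (z : borelRV R D * borelRV R d) : R := kN (dot t z.1) - dot t z.1 * sY z.2.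
have sll t : Theta t -> {ae P, forall w, empirical_loss lambda Yset s X Y n w t @[n --> \oo] --> g t}.
  move=> Tt.
  have phiE i w : phi t (X i w, Y i w) = k (dot t (X i w)) - dot t (X i w) * s (Y i w).
    by rewrite /phi /= kNE// sYE.
  have mphi : measurable_fun setT (phi t).
    have m1 : measurable_fun setT (fun z : borelRV R D * borelRV R d => dot t z.1).
      exact: (measurableT_comp (measurable_dot t) measurable_fst).
    apply: measurable_funB; first exact: (measurableT_comp mkN m1).
    by apply: measurable_funM => //; exact: (measurableT_comp msY measurable_snd).
  have iphi : P.-integrable setT (EFin \o (phi t \o (fun w => (X 0%N w, Y 0%N w)))).
    by apply: eq_integrable (iloss t Tt) => // w _ /=; rewrite phiE.
  apply: filterS (strong_law hiid mphi iphi) => w.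
  rewrite (_ : \int[P]_w _ = g t); last by apply: eq_Rintegral => v _; rewrite phiE.
  rewrite (_ : (fun n => empirical_loss _ _ _ _ _ _ _ _) =
    fun n => n.+1%:R^-1 * \sum_(i < n.+1) phi t (X i w, Y i w))//.
  apply/funext => n; rewrite empE /ridge_loss -mulr_sumr; congr (_ * _).
  by apply: eq_bigr => i _; rewrite phiE.
have slr : {ae P, forall w m, Theta (rational_point m) ->
    empirical_loss lambda Yset s X Y n w (rational_point m) @[n --> \oo] --> g (rational_point m)}.
  apply: ae_foralln => m; have [Tm|nTm] := pselect (Theta (rational_point m)).
    by apply: filterS (sll _ Tm) => w + _.
  by apply: aeW => w /nTm.
have slq : {ae P, forall w, n.+1%:R^-1 * \sum_(i < n.+1) qf (X i w) @[n --> \oo] -->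
    \int[P]_w qf (X 0%N w)}.
  apply: (@strong_law _ _ _ _ _ P _ (fun z : borelRV R D * borelRV R d => qf z.1) hiid) => //.
  exact: (measurableT_comp mqf measurable_fst).
apply: filterS2 slr slq => w slr slq.
have c0 n : 0 <= n.+1%:R^-1 :> R by rewrite invr_ge0.
have cvx n : convex_on Theta (empirical_loss lambda Yset s X Y n w).
  by rewrite empE; apply: (@convex_on_ridge_loss _ _ _ N k k1) => // t i; exact: NX.
split => //.
- by split => //; exact: bounded_set_eball.
- move=> n i j l t /ETheta Tt; rewrite empE.
  by apply: (continuous_third_derivatives_ridge_loss dk dk1 dk2 ck3 _ _ oTheta) => // u m; exact: NX.
- exists g; split => //.
  + exact: convex_cvg_rational.
  + have /cvg_seq_bounded[M [_ HM]] : cvg (n.+1%:R^-1 * \sum_(i < n.+1) qf (X i w) @[n --> \oo]).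
      by apply/cvg_ex; eexists; exact: slq.
    exists (\sum_(i < D) \sum_(j < D) \sum_(l < D) (M + 1)) => n t Et.
    apply: norm_third_derivative_le => i j l; rewrite empE.
    rewrite (le_trans (partial3_ridge_loss_le dk dk1 dk2 _ oTheta _ i j l (ETheta _ Et) (c0 n) (fun m : 'I_n.+1 => k3Q m t w Et)))//.
      by move=> u m; exact: NX.
    (* Boundedness is stated through every number above [M], hence the bound [M + 1]. *)
    have M1 : M < M + 1 by rewrite ltrDl.
    by rewrite (le_trans (ler_norm _))//; exact: (HM _ M1 n I).
  + by right; split.
Qed.
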